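(* Consider the primal problem $$(\mathrm{P})\quad\begin{aligned} \text{minimize}\quad & \langle \mathbf{C},\mathbf{M}\rangle+\epsilon D(\mathbf{M})+\sum_{t\in\mathcal{V}}g_t(\mu_t)+\sum_{(t_1,t_2)\in\mathcal{E}}f_{t_1,t_2}(R_{t_1,t_2})\\ \text{subject to}\quad & P_t(\mathbf{M})=\mu_t,\ t\in\mathcal{V},\qquad P_{t_1,t_2}(\mathbf{M})=R_{t_1,t_2},\ (t_1,t_2)\in\mathcal{E}, \end{aligned}$$ over $\mathbf{M}\in\mathbb{R}_+^{N^{\mathcal{T}}}$, $\mu_t\in\mathbb{R}^N$, $R_{t_1,t_2}\in\mathbb{R}^{N\times N}$. Assume: (a) all elements of $\mathbf{C}$ are finite, and all $g_t$ ($t\in\mathcal{V}$) and $f_{t_1,t_2}$ ($(t_1,t_2)\in\mathcal{E}$) are proper, convex, lower-semicontinuous, and continuous on $\mathrm{dom}(g_t)$ and $\mathrm{dom}(f_{t_1,t_2})$, respectively; (b) there exists a nonnegative tensor $\mathbf{M}$ with $\langle\mathbf{C},\mathbf{M}\rangle<\infty$ whose marginals $\mu_t=P_t(\mathbf{M})$ and bimarginals $R_{t_1,t_2}=P_{t_1,t_2}(\mathbf{M})$ satisfy $g_t(\mu_t)<\infty$ for all $t\in\mathcal{V}$ and $f_{t_1,t_2}(R_{t_1,t_2})<\infty$ for all $(t_1,t_2)\in\mathcal{E}$, and moreover $\mu_t\in\mathrm{ri}(\mathrm{dom}(g_t))$, respectively $R_{t_1,t_2}\in\mathrm{ri}(\mathrm{dom}(f_{t_1,t_2}))$,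 for all those $g_t$ and $f_{t_1,t_2}$ that are not polyhedral; (c) for each $j\in\mathcal{V}$ there exists an elementwise strictly positive $\mu_j\in\mathbb{R}^N$ with $\mu_j\in\mathrm{dom}(g_j)$ if $g_j$ is polyhedral and $\mu_j\in\mathrm{ri}(\mathrm{dom}(g_j))$ if $g_j$ is not polyhedral; and for each $(j_1,j_2)\in\mathcal{E}$ there exists an elementwise strictly positive $R_{j_1,j_2}\in\mathbb{R}^{N\times N}$ with $R_{j_1,j_2}\in\mathrm{dom}(f_{j_1,j_2})$ if $f_{j_1,j_2}$ is polyhedral and $R_{j_1,j_2}\in\mathrm{ri}(\mathrm{dom}(f_{j_1,j_2}))$ if it is not. Let $(u_t^k)_{t\in\mathcal{V}}$ and $(U_{t_1,t_2}^k)_{(t_1,t_2)\in\mathcal{E}}$ be the iterates, at iteration $k$, of the generalized Sinkhorn method (defined in the context), let $\mathbf{U}^k$ be the corresponding tensor $(\mathbf{U}^k)^{(i_1\ldots i_{\mathcal{T}})}=\prod_{t\in\mathcal{V}}(u_t^k)^{(i_t)}\prod_{(t_1,t_2)\in\mathcal{E}}(U_{t_1,t_2}^k)^{(i_{t_1},i_{t_2})}$, and let $\mathbf{M}^k=\mathbf{K}\odot\mathbf{U}^k$. Then $(\mathbf{M}^k)_k$ is a bounded sequence that converges to the optimal solution to $(\mathrm{P})$ (its $\mathbf{M}$-component). Furthermore, if the set of optimal solutions of the dual problem $(\mathrm{D})$ (defined in the context) is nonempty and bounded, then $\big((u_t^k)_{t\in\mathcal{V}},(U_{t_1,t_2}^k)_{(t_1,t_2)\in\mathcal{E}}\big)_k$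 is a bounded sequence and every cluster point of it is an optimal solution to the transformed dual problem $(\mathrm{D}_u)$ (defined in the context).
   Context: Setting: $\mathcal{G}=(\mathcal{V},\mathcal{E})$ is a finite connected graph with $\mathcal{V}=\{1,\dots,\mathcal{T}\}$; each edge is listed in $\mathcal{E}$ as an ordered pair $(t_1,t_2)$ of vertices. $N\ge 1$ is an integer and $\epsilon>0$. $\bar{\mathbb{R}}=\mathbb{R}\cup\{\pm\infty\}$. $\mathbf{C}$ is a $\mathcal{T}$-mode tensor with $N^{\mathcal{T}}$ elements of the form $\mathbf{C}^{(i_1\ldots i_{\mathcal{T}})}=\sum_{(t_1,t_2)\in\mathcal{E}}C_{t_1,t_2}^{(i_{t_1},i_{t_2})}$ for $N\times N$ matrices $C_{t_1,t_2}$. The functions are $g_t:\mathbb{R}^N\to\bar{\mathbb{R}}$ and $f_{t_1,t_2}:\mathbb{R}^{N\times N}\to\bar{\mathbb{R}}$. Notation, with $0\cdot(\pm\infty)=0$: $\langle\mathbf{A},\mathbf{B}\rangle$ is the sum over all indices of the elementwise product; $D(\mathbf{M})=\sum_{i_1,\ldots,i_{\mathcal{T}}}\big(\mathbf{M}^{(i_1\ldots i_{\mathcal{T}})}\log \mathbf{M}^{(i_1\ldots i_{\mathcal{T}})}-\mathbf{M}^{(i_1\ldots i_{\mathcal{T}})}+1\big)$; $\odot$ is the elementwise product; $\exp$, $\log$ of vectors and matrices are elementwise. $P_t(\mathbf{M})\in\mathbb{R}^N$ is obtained by summing $\mathbf{M}^{(i_1\ldots i_{\mathcal{T}})}$ over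 all indices except $i_t$, and $P_{t_1,t_2}(\mathbf{M})\in\mathbb{R}^{N\times N}$ by summing over all indices except $i_{t_1},i_{t_2}$. $\mathrm{dom}(h)=\{x:h(x)<\infty\}$; ''continuous on $\mathrm{dom}(h)$'' refers to $h$ restricted to $\mathrm{dom}(h)$; $\mathrm{ri}$ is relative interior; a convex function is polyhedral if its epigraph is a finite intersection of closed half-spaces; $h^*(x^* )=\sup_x\langle x^*,x\rangle-h(x)$; $\partial h$ is the convex subdifferential. $\mathbf{K}^{(i_1\ldots i_{\mathcal{T}})}=\exp(-\mathbf{C}^{(i_1\ldots i_{\mathcal{T}})}/\epsilon)$. Dual problem $(\mathrm{D})$: maximize over $\lambda_t\in\mathbb{R}^N$, $\Lambda_{t_1,t_2}\in\mathbb{R}^{N\times N}$ the function $-\epsilon\langle\mathbf{K},\mathbf{U}\rangle-\sum_{t}(g_t)^*(-\lambda_t)-\sum_{(t_1,t_2)}(f_{t_1,t_2})^*(-\Lambda_{t_1,t_2})$, where $\mathbf{U}^{(i_1\ldots i_{\mathcal{T}})}=\prod_{t}u_t^{(i_t)}\prod_{(t_1,t_2)}U_{t_1,t_2}^{(i_{t_1},i_{t_2})}$ with $u_t=\exp(\lambda_t/\epsilon)$, $U_{t_1,t_2}=\exp(\Lambda_{t_1,t_2}/\epsilon)$. The transformed dual problem $(\mathrm{D}_u)$ is the same problem expressed in the (positive) variables $u_t,U_{t_1,t_2}$: maximize $-\epsilon\langle\mathbf{K},\mathbf{U}\rangle-\sum_t(g_t)^*(-\epsilon\log u_t)-\sum_{(t_1,t_2)}(f_{t_1,t_2})^*(-\epsilon\log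 U_{t_1,t_2})$. Generalized Sinkhorn method: start from elementwise positive $(u_t^0)_{t\in\mathcal{V}}$, $(U_{t_1,t_2}^0)_{(t_1,t_2)\in\mathcal{E}}$. In each iteration $k=1,2,\dots$, go once, in a fixed order, through all $j\in\mathcal{V}$ and all $(j_1,j_2)\in\mathcal{E}$, and update the corresponding variable while keeping all the other variables fixed at their most recent values: $u_j$ is replaced by a solution of $$0\in -u_j\odot w_j+\partial (g_j)^*\big(-\epsilon\log u_j\big),$$ and $U_{j_1,j_2}$ by a solution of $$0\in -U_{j_1,j_2}\odot W_{j_1,j_2}+\partial (f_{j_1,j_2})^*\big(-\epsilon\log U_{j_1,j_2}\big),$$ where $w_j\in\mathbb{R}^N$ is $P_j(\mathbf{K}\odot\mathbf{U})$ divided elementwise by $u_j$ and $W_{j_1,j_2}\in\mathbb{R}^{N\times N}$ is $P_{j_1,j_2}(\mathbf{K}\odot\mathbf{U})$ divided elementwise by $U_{j_1,j_2}$ (these do not depend on $u_j$, respectively $U_{j_1,j_2}$). The values after the full pass are $(u_t^k)$, $(U_{t_1,t_2}^k)$. (Equivalently, each update exactly maximizes the dual objective over one block $\lambda_j=\epsilon\log u_j$ or $\Lambda_{j_1,j_2}=\epsilon\log U_{j_1,j_2}$.) *)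

(* Defs.v *)
From HB Require Import structures.
From mathcomp Require Import all_boot all_order all_algebra.
From mathcomp Require Import all_classical all_reals all_analysis.

Set Implicit Arguments.
Unset Strict Implicit.
Unset Printing Implicit Defensive.

Import Order.TTheory GRing.Theory Num.Theory.
Import numFieldNormedType.Exports.

Local Open Scope classical_set_scope.
Local Open Scope ring_scope.

(* Vectors of R^N are 'rV[R]_N = 'M[R]_(1, N), so every notion below, stated on
   'M[R]_(m, n), covers both R^N and R^(N x N). *)
Section ConvexAnalysis.
Context {R : realType} {m n : nat}.
Local Notation V := 'M[R]_(m, n).
Implicit Types (h : V -> \bar R) (A : set V) (x y s : V).

Definition dot x y : R := \sum_i \sum_j x i j * y i j.

Definition hadamard x y : V := map2_mx *%R x y.

Definition hquot x y : V := map2_mx (fun a b => a / b) x y.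

Definition posmx x : Prop := forall i j, 0 < x i j.

Definition dom h : set V := [set x | (h x < +oo)%E].

Definition proper_fun h : Prop :=
  (forall x, h x != -oo%E) /\ (exists x, dom h x).

Definition epigraph h : set (V * R^o) := [set p | (h p.1 <= p.2%:E)%E].

Definition convex_efun h : Prop := convex_set (epigraph h).

Definition half_space (a : V) (b c : R) : set (V * R^o) :=
  [set p | dot a p.1 + b * p.2 <= c].

Definition polyhedral h : Prop :=
  exists (l : nat) (a : 'I_l -> V) (b c : 'I_l -> R),
    (forall k, (a k != 0) || (b k != 0)) /\
    epigraph h = \bigcap_(k in setT) half_space (a k) (b k) (c k).

Definition affine_hull A : set V :=
  [set x | exists (l : nat) (p : 'I_l -> V) (c : 'I_l -> R),
     [/\ forall k, A (p k), \sum_k c k = 1 & x = \sum_k c k *: p k]].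

Definition rel_interior A : set V :=
  [set x | affine_hull A x /\ \forall y \near x, affine_hull A y -> A y].

Definition conjugate h (x' : V) : \bar R :=
  ereal_sup [set ((dot x' x)%:E - h x)%E | x in setT].

(* Empty when h x = +oo and h is proper. *)
Definition subdifferential h x : set V :=
  [set s | forall y, (h x + (dot s (y - x))%:E <= h y)%E].

Definition standing_fun h : Prop :=
  [/\ proper_fun h, convex_efun h, lower_semicontinuous h
    & {within dom h, continuous h}].

End ConvexAnalysis.

Section Graph.
Context {T : nat}.
Implicit Types E : {set 'I_T * 'I_T}.

(* No loops, and each edge is listed with one orientation only. *)
Definition simple_graph E : Prop :=
  forall t1 t2, (t1, t2) \in E -> t1 != t2 /\ (t2, t1) \notin E.

Definition connected_graph E : Prop :=
  (0 < T)%N /\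
  forall s t : 'I_T,
    connect [rel x y | ((x, y) \in E) || ((y, x) \in E)] s t.

Definition edge E := {e : 'I_T * 'I_T | e \in E}.

Definition esrc E (e : edge E) : 'I_T := (val e).1.
Definition etgt E (e : edge E) : 'I_T := (val e).2.

End Graph.

Section Problem.
Context {R : realType} {T N : nat} {E : {set 'I_T * 'I_T}}.

Definition mindex := {ffun 'I_T -> 'I_N}.

(* Topology of entrywise convergence. *)
Definition tensor := {ptws mindex -> R}.

(* One vector per vertex and one matrix per edge, with the product topology. *)
Definition blocks :=
  ({ptws 'I_T -> 'rV[R]_N} * {ptws edge E -> 'M[R]_N})%type.

Definition marginal (t : 'I_T) (M : tensor) : 'rV[R]_N :=
  \row_a \sum_(i : mindex | i t == a) M i.

Definition bimarginal (e : edge E) (M : tensor) : 'M[R]_N :=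
  \matrix_(a, b) \sum_(i : mindex | (i (esrc e) == a) && (i (etgt e) == b)) M i.

Definition nonneg_tensor (M : tensor) : Prop := forall i, 0 <= M i.

Definition bounded_tensors (M : nat -> tensor) : Prop :=
  exists B : R, forall k i, `|M k i| <= B.

(* `|_| on 'M[R]_(m, n) is the maximum norm. *)
Definition bounded_blocks (A : set blocks) : Prop :=
  exists B : R, forall x, A x ->
    (forall t, `|x.1 t| <= B) /\ (forall e, `|x.2 e| <= B).

Definition pos_blocks (x : blocks) : Prop :=
  (forall t, posmx (x.1 t)) /\ (forall e, posmx (x.2 e)).

Definition scaling_tensor (x : blocks) : tensor := fun i =>
  (\prod_(t < T) x.1 t ord0 (i t)) *
  (\prod_(e : edge E) x.2 e (i (esrc e)) (i (etgt e))).

(* The term at 0 is 1, as ln 0 = 0. *)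
Definition entropy (M : tensor) : R :=
  \sum_(i : mindex) (M i * ln (M i) - M i + 1).

Definition cost_tensor (C : edge E -> 'M[\bar R]_N) (i : mindex) : \bar R :=
  (\sum_(e : edge E) C e (i (esrc e)) (i (etgt e)))%E.

(* The product of \bar R satisfies 0 * +oo = 0. *)
Definition cost_value (C : edge E -> 'M[\bar R]_N) (M : tensor) : \bar R :=
  (\sum_(i : mindex) cost_tensor C i * (M i)%:E)%E.

Context (eps : R) (C : edge E -> 'M[\bar R]_N)
  (g : 'I_T -> 'rV[R]_N -> \bar R) (f : edge E -> 'M[R]_N -> \bar R).

Definition gibbs : tensor := fun i =>
  fine (expeR (- cost_tensor C i * (eps^-1)%:E)%E).

Definition scaled_gibbs (x : blocks) : tensor :=
  fun i => gibbs i * scaling_tensor x i.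

(* A point of the primal problem is (M, (mu, R)). *)
Definition primal_feasible (p : tensor * blocks) : Prop :=
  [/\ nonneg_tensor p.1, forall t, marginal t p.1 = p.2.1 t
    & forall e, bimarginal e p.1 = p.2.2 e].

Definition primal_objective (p : tensor * blocks) : \bar R :=
  (cost_value C p.1 + (eps * entropy p.1)%:E
   + \sum_(t < T) g t (p.2.1 t) + \sum_(e : edge E) f e (p.2.2 e))%E.

Definition primal_optimal (p : tensor * blocks) : Prop :=
  primal_feasible p /\
  forall q, primal_feasible q ->
    (primal_objective p <= primal_objective q)%E.

Definition exp_blocks (l : blocks) : blocks :=
  (fun t => map_mx expR (eps^-1 *: l.1 t),
   fun e => map_mx expR (eps^-1 *: l.2 e)).

Definition dual_objective (l : blocks) : \bar R :=
  ((- eps * \sum_(i : mindex) gibbs i * scaling_tensor (exp_blocks l) i)%:E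
   - \sum_(t < T) conjugate (g t) (- l.1 t)
   - \sum_(e : edge E) conjugate (f e) (- l.2 e))%E.

Definition dual_optimal : set blocks :=
  [set l | forall l', (dual_objective l' <= dual_objective l)%E].

Definition log_block {m n : nat} (u : 'M[R]_(m, n)) : 'M[R]_(m, n) :=
  eps *: map_mx (@ln R) u.

Definition dualu_objective (x : blocks) : \bar R :=
  ((- eps * \sum_(i : mindex) gibbs i * scaling_tensor x i)%:E
   - \sum_(t < T) conjugate (g t) (- log_block (x.1 t))
   - \sum_(e : edge E) conjugate (f e) (- log_block (x.2 e)))%E.

Definition dualu_optimal : set blocks :=
  [set x | pos_blocks x /\
     forall y, pos_blocks y -> (dualu_objective y <= dualu_objective x)%E].

Definition vertex_weight (j : 'I_T) (x : blocks) : 'rV[R]_N :=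
  hquot (marginal j (scaled_gibbs x)) (x.1 j).

Definition edge_weight (j : edge E) (x : blocks) : 'M[R]_N :=
  hquot (bimarginal j (scaled_gibbs x)) (x.2 j).

Definition sinkhorn_inclusion {m n : nat} (h : 'M[R]_(m, n) -> \bar R)
    (u w : 'M[R]_(m, n)) : Prop :=
  [set - hadamard u w + s
    | s in subdifferential (conjugate h) (- log_block u)] 0.

(* x is the state before, y the state after the update of a single block. *)
Definition block_update (b : 'I_T + edge E) (x y : blocks) : Prop :=
  match b with
  | inl j =>
      [/\ forall t, t != j -> y.1 t = x.1 t, forall e, y.2 e = x.2 e,
          posmx (y.1 j)
        & sinkhorn_inclusion (g j) (y.1 j) (vertex_weight j x)]
  | inr j =>
      [/\ forall t, y.1 t = x.1 t, forall e, e != j -> y.2 e = x.2 e,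
          posmx (y.2 j)
        & sinkhorn_inclusion (f j) (y.2 j) (edge_weight j x)]
  end.

Fixpoint sinkhorn_pass (order : seq ('I_T + edge E)) (x y : blocks) : Prop :=
  match order with
  | [::] => y = x
  | b :: order' => exists2 z, block_update b x z & sinkhorn_pass order' z y
  end.

Definition sinkhorn_iterates (x : nat -> blocks) : Prop :=
  exists order : seq ('I_T + edge E),
    [/\ uniq order, forall b, b \in order, pos_blocks (x 0)
      & forall k, sinkhorn_pass order (x k) (x k.+1)].

Definition assumption_a : Prop :=
  [/\ forall i, cost_tensor C i \is a fin_num,
      forall t, standing_fun (g t) & forall e, standing_fun (f e)].

Definition assumption_b : Prop :=
  exists M : tensor,
    [/\ nonneg_tensor M,
        (cost_value C M < +oo)%E,
        forall t, (g t (marginal t M) < +oo)%E,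
        forall e, (f e (bimarginal e M) < +oo)%E
      & (forall t, ~ polyhedral (g t) ->
           rel_interior (dom (g t)) (marginal t M)) /\
        (forall e, ~ polyhedral (f e) ->
           rel_interior (dom (f e)) (bimarginal e M))].

Definition pos_domain_point {m n : nat} (h : 'M[R]_(m, n) -> \bar R) : Prop :=
  exists x, [/\ posmx x, polyhedral h -> dom h x
              & ~ polyhedral h -> rel_interior (dom h) x].

Definition assumption_c : Prop :=
  (forall j, pos_domain_point (g j)) /\ (forall e, pos_domain_point (f e)).

End Problem.

Arguments mindex : clear implicits.
Arguments tensor : clear implicits.
Arguments blocks : clear implicits.

(* Main.v *)
(* Each block update maximizes the dual objective over one block, so by Fermat's
   rule and Fenchel-Moreau -lambda_b is a subgradient of h_b (one of the g_t,
   f_e) at the marginal A_b M taken right after the update, and the dual gain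
   is at least eps KL(M_new | M_old) >= eps |sqrt M_new - sqrt M_old|^2.  For a
   feasible M the duality gap of lambda is eps KL(M | M(lambda)) plus the
   nonnegative terms h_b(A_b M) + h_b^*(-lambda_b) + <lambda_b, A_b M>, up to a
   constant.  Hence the M^k are bounded, and the intermediate tensors of a pass
   are asymptotically equal.

   Along an ultrafilter M^k converges to some M.  Although the multipliers may
   diverge, the qualification hypotheses give
   limsup <-lambda_b, A_b M_b^k - A_b M> <= 0, where M_b^k is the tensor just
   after the update of block b; this also puts A_b M in dom h_b.  Summing the
   subgradient inequalities yields, for every feasible M',
   P(M') >= P(M) + eps limsup KL(M' | M^k), so M is the unique minimizer and the
   whole sequence converges.

   If the dual optimal set is bounded, concavity of the dual objective bounds
   the iterates; a limit lambda has no duality gap against M, hence is dual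
   optimal. *)
Require Import Defs.
From HB Require Import structures.
From mathcomp Require Import all_boot all_order all_algebra.
From mathcomp Require Import all_classical all_reals all_analysis.
From mathcomp Require Import ring lra.
Set Implicit Arguments.
Unset Strict Implicit.
Unset Printing Implicit Defensive.
Import Order.TTheory GRing.Theory Num.Theory.
Import numFieldNormedType.Exports.
Local Open Scope classical_set_scope.
Local Open Scope ring_scope.

(** * Limits along ultrafilters *)

Section Filters.
Context {R : realType}.

(** The values stay in a compact segment, so they have a cluster point, and a cluster point along an
    ultrafilter is a limit: each preimage or its complement belongs to [U]. This takes the place of
    extracting subsequences. *)
Lemma ultra_bounded_cvg {T : Type} (U : set_system T) (u : T -> R) (B : R) :
  UltraFilter U -> (\forall t \near U, `|u t| <= B) ->
  exists l : R, u t @[t --> U] --> l.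
Proof.
move=> UU uB.
have uB' : (u @ U) `[- B, B]%classic.
  by apply: filterS uB => t /=; rewrite ler_norml in_itv.
have [p [_ clp]] := segment_compact (fmap_proper_filter u _) uB'.
exists p => A pA.
have [//|UC] := in_ultra_setVsetC (u @^-1` A) UU.
by have [z []] := clp (~` A) A UC pA.
Qed.

(** If a neighbourhood of [l] were missed infinitely often, [\oo] restricted to the indices that
    miss it would be a proper filter, and an ultrafilter above it would contradict the
    hypothesis. *)
Lemma ultra_cvg_oo {V : topologicalType} (u : nat -> V) (l : V) :
  (forall U, UltraFilter U -> \oo `<=` U -> u @ U --> l) -> u @ \oo --> l.
Proof.
move=> H A lA; apply: contrapT => nA.
have PF : ProperFilter (within (~` (u @^-1` A)) \oo).
  split; last exact: within_filter.
  rewrite /within/= => W; apply: nA; move: W; apply: filterS => n W.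
  by apply: contrapT => /W.
have [U [UU FU]] := ultraFilterLemma PF.
have ooU : \oo `<=` U by move=> S oS; apply: FU; move: oS; apply: filterS => n Sn _.
have UA : U (u @^-1` A) by exact: H.
have UC : U (~` (u @^-1` A)) by apply: FU; exact: withinT.
by have [z []] := filter_ex (filterI UA UC).
Qed.

Lemma cvg_finsum {T : Type} (F : set_system T) (FF : Filter F) (I : finType)
    (P : pred I) (f : T -> I -> R) (l : I -> R) :
  (forall i, P i -> f t i @[t --> F] --> l i) ->
  \sum_(i | P i) f t i @[t --> F] --> \sum_(i | P i) l i.
Proof.
move=> H.
have -> : (fun t => \sum_(i | P i) f t i) = \sum_(i | P i) (f^~ i).
  by apply/funext => t; rewrite fct_sumE.
elim/big_ind2 : _ => //; first exact: cvg_cst.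
by move=> f1 l1 f2 l2 h1 h2; exact: cvgD.
Qed.

Lemma cvg_mx {T : Type} (F : set_system T) (FF : Filter F) (m n : nat)
    (f : T -> 'M[R]_(m, n)) (l : 'M[R]_(m, n)) :
  (forall i j, f t i j @[t --> F] --> l i j) -> f @ F --> l.
Proof.
move=> H A [P lP PA].
have : \forall t \near F, forall i j, P i j (f t i j).
  apply: filter_forall => i; apply: filter_forall => j.
  exact: (H i j _ (lP i j)).
by apply: filterS => t Pt; apply: PA => i j; exact: Pt.
Qed.

Lemma cvg_mx_coord {T : Type} (F : set_system T) (FF : Filter F) (m n : nat)
    (f : T -> 'M[R]_(m, n)) (l : 'M[R]_(m, n)) i j :
  f @ F --> l -> f t i j @[t --> F] --> l i j.
Proof. by move=> H; exact: (cvg_comp _ _ H (@coord_continuous _ _ _ i j l)). Qed.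

Lemma cvg_ge_near {T : Type} (F : set_system T) (FF : ProperFilter F)
    (f : T -> R) (l a : R) :
  f @ F --> l -> (\forall t \near F, a <= f t) -> a <= l.
Proof.
move=> fl fa; rewrite -(cvg_lim _ fl)//; apply: limr_ge => //.
by apply/cvg_ex; exists l.
Qed.

Lemma cvg_le_near {T : Type} (F : set_system T) (FF : ProperFilter F)
    (f : T -> R) (l a : R) :
  f @ F --> l -> (\forall t \near F, f t <= a) -> l <= a.
Proof.
move=> fl fa; rewrite -(cvg_lim _ fl)//; apply: limr_le => //.
by apply/cvg_ex; exists l.
Qed.

End Filters.

(** * The entrywise inner product of matrices *)

Section Dot.
Context {R : realType} {m n : nat}.
Implicit Types x y z : 'M[R]_(m, n).

Lemma dotC x y : dot x y = dot y x.
Proof. by apply: eq_bigr => i _; apply: eq_bigr => j _; rewrite mulrC. Qed.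

Lemma dotDr x y z : dot x (y + z) = dot x y + dot x z.
Proof.
rewrite /dot -big_split; apply: eq_bigr => i _; rewrite -big_split.
by apply: eq_bigr => j _; rewrite mxE mulrDr.
Qed.

Lemma dotZr (a : R) x y : dot x (a *: y) = a * dot x y.
Proof.
rewrite /dot mulr_sumr; apply: eq_bigr => i _; rewrite mulr_sumr.
by apply: eq_bigr => j _; rewrite mxE mulrCA.
Qed.

Lemma dotNr x y : dot x (- y) = - dot x y.
Proof. by rewrite -scaleN1r dotZr mulN1r. Qed.

Lemma dotBr x y z : dot x (y - z) = dot x y - dot x z.
Proof. by rewrite dotDr dotNr. Qed.

Lemma dotDl x y z : dot (x + y) z = dot x z + dot y z.
Proof. by rewrite dotC dotDr !(dotC z). Qed.

Lemma dotZl (a : R) x y : dot (a *: x) y = a * dot x y.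
Proof. by rewrite dotC dotZr dotC. Qed.

Lemma dotNl x y : dot (- x) y = - dot x y.
Proof. by rewrite dotC dotNr dotC. Qed.

Lemma dotBl x y z : dot (x - y) z = dot x z - dot y z.
Proof. by rewrite dotDl dotNl. Qed.

Lemma dot0r x : dot x 0 = 0.
Proof. by rewrite -(scale0r x) dotZr mul0r. Qed.

Lemma dot_ge0 x : 0 <= dot x x.
Proof.
by apply: sumr_ge0 => i _; apply: sumr_ge0 => j _; rewrite -expr2 sqr_ge0.
Qed.

Lemma sqr_coord_le_dot x i j : x i j ^+ 2 <= dot x x.
Proof.
rewrite /dot (bigD1 i)//= (bigD1 j)//= -expr2 -addrA lerDl addr_ge0//.
  by apply: sumr_ge0 => k _; rewrite -expr2 sqr_ge0.
by apply: sumr_ge0 => k _; apply: sumr_ge0 => l _; rewrite -expr2 sqr_ge0.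
Qed.

Lemma dot_eq0 x : dot x x <= 0 -> x = 0.
Proof.
move=> x0; apply/matrixP => i j; rewrite mxE; apply/eqP.
by rewrite -sqrf_eq0 eq_le sqr_ge0 andbT (le_trans (sqr_coord_le_dot x i j)).
Qed.

Lemma cvg_dot {T : Type} (F : set_system T) (FF : Filter F)
    (f g : T -> 'M[R]_(m, n)) x y :
  f @ F --> x -> g @ F --> y -> dot (f t) (g t) @[t --> F] --> dot x y.
Proof.
move=> fx gy; apply: cvg_finsum => i _; apply: cvg_finsum => j _.
by apply: cvgM; exact: cvg_mx_coord.
Qed.

End Dot.

(** * Convex conjugates and the Fenchel-Moreau theorem *)

Section FenchelMoreau.
Context {R : realType} {m n : nat}.
Local Notation V := 'M[R]_(m, n).
Implicit Types (h : V -> \bar R) (x y p q s : V).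

Lemma convex_efun_comb h x y (a b t : R) : convex_efun h ->
  0 <= t <= 1 -> (h x <= a%:E)%E -> (h y <= b%:E)%E ->
  (h (t *: x + (1 - t) *: y)%R <= (t * a + (1 - t) * b)%:E)%E.
Proof.
move=> hc /andP[t0 t1] xa yb.
have t01 : Itv.spec (@Itv.num_sem R) (Itv.Real `[0%Z, 1%Z]) t.
  by rewrite /= /Itv.num_sem/= num_real/= in_itv/= t0 t1.
have := hc (x, a : R^o) (y, b : R^o) (Itv.Def t01).
by rewrite !inE => /(_ xa yb).
Qed.

Lemma lsc_cvg_le {T : Type} (F : set_system T) (FF : ProperFilter F) h
    (f : T -> V) (s : T -> R) x (s0 : R) :
  lower_semicontinuous h -> f @ F --> x -> s @ F --> s0 ->
  (\forall t \near F, (h (f t) <= (s t)%:E)%E) -> (h x <= s0%:E)%E.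
Proof.
move=> hl fx ss0 hs; rewrite leNgt; apply/negP => s0h.
have [a s0a ah] : exists2 a, s0 < a & (a%:E < h x)%E.
  case: (h x) s0h => [v||] //.
    rewrite lte_fin => s0v; exists ((s0 + v) / 2); rewrite ?lte_fin; lra.
  by exists (s0 + 1); rewrite ?ltry// ltrDl.
have [W xW Wa] := hl x a ah.
have /= H1 := fx _ xW.
have H2 : \forall t \near F, s t < a by exact: (cvgr_lt _ ss0).
have [t [[H4 H5] H6]] := filter_ex (filterI (filterI hs H1) H2).
have := lt_le_trans (Wa _ H5) H4.
by rewrite lte_fin ltNge (ltW H6).
Qed.

Lemma conjugate_leP h p (c : R) : (forall x, h x != -oo%E) ->
  (conjugate h p <= c%:E)%E <->
  (forall x (v : R), h x = v%:E -> dot p x - v <= c).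
Proof.
move=> hN; split.
  move=> hc x v hv; rewrite -lee_fin; apply: le_trans hc.
  by apply: ereal_sup_ubound; exists x => //; rewrite hv.
move=> H; apply: ge_ereal_sup => _ [x _ <-].
case E : (h x) (hN x) => [v||] //= _; first by rewrite lee_fin; exact: H.
by rewrite leNye.
Qed.

Lemma conjugate_neqNy h p : proper_fun h -> conjugate h p != -oo%E.
Proof.
move=> [hN [x hx]]; rewrite -ltNye.
apply: (@lt_le_trans _ _ ((dot p x)%:E - h x)%E); last first.
  by apply: ereal_sup_ubound; exists x.
rewrite /dom/= in hx.
by case: (h x) (hN x) hx => [v||] //= _ _; rewrite ltNye.
Qed.

(** [(x0, s0)] is a point of the epigraph nearest to [(y, r)]; the inequality is the obtuse-angle
    property of projection onto a convex set. *)
Lemma epigraph_projection h y (r : R) :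
  proper_fun h -> convex_efun h -> lower_semicontinuous h ->
  exists x0 (s0 : R), (h x0 <= s0%:E)%E /\
    forall x (s : R), (h x <= s%:E)%E ->
      dot (y - x0) (x - x0) + (r - s0) * (s - s0) <= 0.
Proof.
move=> [hN [x1 hx1]] hc hl.
pose val (z : V * R) := dot (z.1 - y) (z.1 - y) + (z.2 - r) ^+ 2.
pose D : set R := [set val z | z in [set z : V * R | (h z.1 <= z.2%:E)%E]].
have D0 : has_inf D.
  split.
    rewrite /dom/= in hx1.
    case E : (h x1) (hN x1) hx1 => [v||] //= _ _.
    by exists (val (x1, v)), (x1, v) => //=; rewrite E.
  by exists 0 => _ [z _ <-]; rewrite addr_ge0 ?dot_ge0 ?sqr_ge0.
(* A minimizing sequence for the squared distance [val]; it is bounded, and lower semicontinuity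
   keeps its ultrafilter limit in the epigraph. *)
have /choice[z zP] : forall k : nat, exists z : V * R,
    (h z.1 <= z.2%:E)%E /\ val z < inf D + k.+1%:R^-1.
  move=> k; have k0 : (0 : R) < k.+1%:R^-1 by rewrite invr_gt0.
  by have [_ [w wE <-] wl] := inf_adherent k0 D0; exists w.
have infle w : (h w.1 <= w.2%:E)%E -> inf D <= val w.
  by move=> wE; apply: (inf_lbound D0.2); exists w.
have [U [UU ooU]] := ultraFilterLemma (@eventually_filter).
have bnd k : val (z k) <= inf D + 1.
  apply: (le_trans (ltW (zP k).2)); rewrite lerD2l.
  by rewrite invf_le1// ler1n.
have sqb (a c : R) : a ^+ 2 <= c -> `|a| <= c + 1.
  move=> ac; apply/ler_normlP; split; nra.
have /choice[l1 l1P] : forall ij : 'I_m * 'I_n, exists l : R,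
    (z k).1 ij.1 ij.2 @[k --> U] --> l.
  move=> [i j] /=.
  apply: (@ultra_bounded_cvg _ _ _ _ (inf D + 1 + 1 + `|y i j|)) => //.
  apply: filterE => k /=.
  have : `|(z k).1 i j - y i j| <= inf D + 1 + 1.
    apply: sqb; apply: le_trans (bnd k).
    have := sqr_coord_le_dot ((z k).1 - y) i j; rewrite !mxE => H.
    by apply: (le_trans H); rewrite lerDl sqr_ge0.
  move=> H; rewrite -[X in `|X|](subrK (y i j)).
  by apply: (le_trans (ler_normD _ _)); rewrite lerD2r.
have [l2 l2P] : exists l : R, (z k).2 @[k --> U] --> l.
  apply: (@ultra_bounded_cvg _ _ _ _ (inf D + 1 + 1 + `|r|)) => //.
  apply: filterE => k /=.
  have : `|(z k).2 - r| <= inf D + 1 + 1.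
    by apply: sqb; apply: le_trans (bnd k); rewrite lerDr dot_ge0.
  move=> H; rewrite -[X in `|X|](subrK r).
  by apply: (le_trans (ler_normD _ _)); rewrite lerD2r.
pose x0 : V := \matrix_(i, j) l1 (i, j).
have zx0 : (z k).1 @[k --> U] --> x0.
  by apply: cvg_mx => i j; rewrite mxE; exact: (l1P (i, j)).
have E0 : (h x0 <= l2%:E)%E.
  apply: (@lsc_cvg_le _ U _ h (fun k => (z k).1) (fun k => (z k).2)) => //.
  by apply: filterE => k; exact: (zP k).1.
have vz : val (z k) @[k --> U] --> val (x0, l2).
  apply: cvgD => /=.
    by apply: cvg_dot; apply: cvgB => //; exact: cvg_cst.
  by rewrite expr2; under eq_fun do rewrite expr2; apply: cvgM; apply: cvgB => //;
    exact: cvg_cst.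
have v0 : val (x0, l2) = inf D.
  apply/eqP; rewrite eq_le infle//= andbT.
  have hc1 : (inf D + k.+1%:R^-1) @[k --> U] --> inf D.
    rewrite -[X in _ --> X]addr0; apply: cvgD; first exact: cvg_cst.
    by apply: cvg_trans (@cvg_harmonic R) => A /ooU.
  rewrite -subr_le0.
  apply: (@cvg_le_near _ _ U _ (fun k => val (z k) - (inf D + k.+1%:R^-1))).
    exact: cvgB.
  by apply: filterE => k; rewrite subr_le0 ltW// (zP k).2.
exists x0, l2; split => // x s xs.
pose L := dot (x0 - y) (x - x0) + (l2 - r) * (s - l2).
pose Q := dot (x - x0) (x - x0) + (s - l2) ^+ 2.
have Q0 : 0 <= Q by rewrite addr_ge0 ?dot_ge0 ?sqr_ge0.
suff L0 : 0 <= L.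
  have -> : dot (y - x0) (x - x0) + (r - l2) * (s - l2) = - L.
    by rewrite /L -(opprB x0 y) dotNl; ring.
  by rewrite oppr_le0.
(* Minimality of [(x0, l2)] against the point of parameter [t] on the segment towards [(x, s)]. *)
have key t : 0 <= t <= 1 -> 0 <= t * (2 * L + t * Q).
  move=> t01; have := infle (t *: x + (1 - t) *: x0, t * s + (1 - t) * l2).
  move=> /(_ (convex_efun_comb hc t01 xs E0)); rewrite -v0 /val/=.
  have -> : t *: x + (1 - t) *: x0 - y = (x0 - y) + t *: (x - x0).
    by apply/matrixP => i j; rewrite !mxE; ring.
  rewrite /L /Q; move: (x0 - y) (x - x0) => a b.
  rewrite !(dotDl, dotDr, dotZl, dotZr) (dotC b a); nra.
rewrite leNgt; apply/negP => L0.
have QL : 0 < Q - L by lra.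
(* For [L < 0] this parameter makes [2 * L + t * Q] negative; the denominator [Q - L], unlike [Q],
   cannot vanish. *)
have := key (- L / (Q - L)).
have -> : 0 <= - L / (Q - L) <= 1.
  by rewrite divr_ge0 ?ler_pdivrMr//=; lra.
move=> /(_ isT); rewrite pmulr_rge0; last by rewrite divr_gt0//; lra.
have -> : 2 * L + - L / (Q - L) * Q = (L * (Q - 2 * L)) / (Q - L).
  by field; rewrite gt_eqF.
by rewrite pmulr_lge0 ?invr_gt0//; nra.
Qed.

(** For [r < s0] the supporting hyperplane with normal [(y - x0, r - s0)] is not vertical, and
    dividing by [s0 - r] turns it into the graph of an affine minorant. *)
Lemma conjugate_le_of_support h y x0 (r s0 : R) : (forall x, h x != -oo%E) ->
  r < s0 ->
  (forall x (s : R), (h x <= s%:E)%E ->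
      dot (y - x0) (x - x0) + (r - s0) * (s - s0) <= 0) ->
  (conjugate h ((s0 - r)^-1 *: (y - x0))%R <=
    (dot ((s0 - r)^-1 *: (y - x0)) x0 - s0)%:E)%E.
Proof.
move=> hN rs H; apply/conjugate_leP => // x v xv.
have {}H := H x v _; rewrite xv lexx in H; have {H} := H isT.
rewrite !dotZl dotBr => H.
suff : (dot (y - x0) x - dot (y - x0) x0) / (s0 - r) <= v - s0.
  by rewrite mulrBl ![_ / _]mulrC; lra.
by rewrite ler_pdivrMr ?subr_gt0//; lra.
Qed.

(** Project a point one unit below the graph. Were the supporting hyperplane vertical, the point
    would be its own projection, although it lies outside the epigraph. *)
Lemma exists_affine_minorant h :
  proper_fun h -> convex_efun h -> lower_semicontinuous h ->
  exists p (c : R), (conjugate h p <= c%:E)%E.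
Proof.
move=> hp hc hl; have [hN [x1 hx1]] := hp.
rewrite /dom/= in hx1.
case E : (h x1) (hN x1) hx1 => [v||] //= _ _.
have [x0 [s0 [E0 H]]] := epigraph_projection x1 (v - 1) hp hc hl.
have [rs|sr] := ltP (v - 1) s0.
  by eexists; eexists; exact: (conjugate_le_of_support hN rs H).
have /H H1 : (h x1 <= v%:E)%E by rewrite E.
have /H : (h x0 <= (s0 + 1)%:E)%E.
  by apply: (le_trans E0); rewrite lee_fin lerDl.
rewrite subrr dot0r => H2.
have s0v : s0 = v - 1 by lra.
have D0 : x1 - x0 = 0 by apply: dot_eq0; rewrite s0v in H1; lra.
move: E0; rewrite -(subrK x0 x1) D0 add0r in E; rewrite E lee_fin; lra.
Qed.

(** If [(y, r)] were outside the epigraph, a hyperplane would separate it. A nonvertical one is an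
    affine minorant exceeding [r] at [y]; a vertical one gives such a minorant by tilting an
    existing one. *)
Lemma fenchel_moreau h y (r : R) :
  proper_fun h -> convex_efun h -> lower_semicontinuous h ->
  (forall p (c : R), (conjugate h p <= c%:E)%E -> dot p y - c <= r) ->
  (h y <= r%:E)%E.
Proof.
move=> hp hc hl H; have [hN _] := hp.
have [x0 [s0 [E0 S]]] := epigraph_projection y r hp hc hl.
have [rs|sr] := ltP r s0.
  exfalso; have := H _ _ (conjugate_le_of_support hN rs S).
  rewrite dotZl dotZl opprB addrCA -mulrBr -dotBr.
  have : 0 <= (s0 - r)^-1 * dot (y - x0) (y - x0).
    by rewrite mulr_ge0 ?dot_ge0// invr_ge0 subr_ge0 ltW.
  lra.
have /S : (h x0 <= (s0 + 1)%:E)%E.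
  by apply: (le_trans E0); rewrite lee_fin lerDl.
rewrite subrr dot0r => H2.
have s0r : s0 = r by lra.
have [p1 [c1 pc1]] := exists_affine_minorant hp hc hl.
have [Q0|Q0] := leP (dot (y - x0) (y - x0)) 0.
  by rewrite -(subrK x0 y) (dot_eq0 Q0) add0r -s0r.
exfalso.
(* Since [dot (y - x0) (x - x0) <= 0] on the domain, tilting [p1] by any nonnegative multiple of
   [y - x0] preserves minorization; this multiple lifts the value at [y] above [r]. *)
pose t := (`|r - dot p1 y + c1| + 1) / dot (y - x0) (y - x0).
have t0 : 0 <= t by rewrite divr_ge0// ltW.
have /H : (conjugate h (p1 + t *: (y - x0))%R <=
    (c1 + t * dot (y - x0) x0)%:E)%E.
  apply/conjugate_leP => // x v xv.
  have /(conjugate_leP _ _ hN)/(_ _ _ xv) := pc1.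
  have := S x v; rewrite xv lexx => /(_ isT).
  rewrite (dotDl p1) dotZl dotBr s0r; nra.
rewrite (dotDl p1) dotZl.
have : t * dot (y - x0) (y - x0) = `|r - dot p1 y + c1| + 1.
  by rewrite divfK// gt_eqF.
rewrite [dot _ (y - x0)]dotBr; have := ler_norm (r - dot p1 y + c1); lra.
Qed.

(** This is equality in Fenchel-Young. The subgradient inequality bounds every affine minorant at
    [s] by [dot p s - conjugate h p], so Fenchel-Moreau bounds [h s]; the converse bound is the
    definition of the conjugate. *)
Lemma subdifferential_conjugate h p s :
  proper_fun h -> convex_efun h -> lower_semicontinuous h ->
  subdifferential (conjugate h) p s ->
  exists r : R, h s = r%:E /\ conjugate h p = (dot p s - r)%:E.
Proof.
move=> hp hc hl sd; have [hN _] := hp.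
have [p1 [c1 pc1]] := exists_affine_minorant hp hc hl.
have [c cE] : exists c : R, conjugate h p = c%:E.
  have := le_trans (sd p1) pc1.
  case: (conjugate h p) (conjugate_neqNy p hp) => [c||] // _ _.
  by exists c.
have hs : (h s <= (dot p s - c)%:E)%E.
  apply: fenchel_moreau => // q d qd.
  have := le_trans (sd q) qd; rewrite cE lee_fin dotBr (dotC s q) (dotC s p).
  lra.
case E : (h s) (hN s) hs => [r||] // _; rewrite lee_fin => rc.
exists r; split => //; rewrite cE; congr EFin.
have : (conjugate h p <= c%:E)%E by rewrite cE.
move=> /(conjugate_leP _ _ hN)/(_ _ _ E); lra.
Qed.

End FenchelMoreau.

(** * Limits of subgradient inequalities whose multipliers may diverge *)

Section SubgradientLimits.
Context {R : realType} {m n : nat}.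
Local Notation V := 'M[R]_(m, n).
Implicit Types (h : V -> \bar R) (x y p q s : V).

Lemma proper_dom_fin h x : proper_fun h -> dom h x -> exists v : R, h x = v%:E.
Proof.
move=> [hN _]; rewrite /dom/=.
by case: (h x) (hN x) => [v||] // _ _; exists v.
Qed.

(** The half-spaces with [b k = 0] cut out the domain. All others have [b k < 0], because an
    epigraph is closed upwards, and hold at a large enough height. *)
Lemma polyhedral_dom h : proper_fun h -> polyhedral h ->
  exists (l : nat) (P : pred 'I_l) (a : 'I_l -> V) (c : 'I_l -> R),
    forall y, dom h y <-> (forall k, P k -> dot (a k) y <= c k).
Proof.
move=> hp [l [a [b [c [_ epiE]]]]].
have E y (v : R) : (h y <= v%:E)%E <-> forall k, dot (a k) y + b k * v <= c k.
  change (epigraph h (y, v : R^o) <->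
    forall k, dot (a k) y + b k * v <= c k).
  rewrite epiE; split=> [H k|H k _]; [exact: (H k)|exact: H].
have b0 k : b k <= 0.
  rewrite leNgt; apply/negP => bk.
  have [x1 /(proper_dom_fin hp)[v xv]] := hp.2.
  pose t := (`|c k - dot (a k) x1 - b k * v| + 1) / b k.
  have t0 : 0 <= t by rewrite divr_ge0// ltW.
  have : (h x1 <= (v + t)%:E)%E by rewrite xv lee_fin lerDl.
  move=> /E/(_ k); rewrite mulrDr.
  have -> : b k * t = `|c k - dot (a k) x1 - b k * v| + 1.
    by rewrite mulrC divfK// gt_eqF.
  have := ler_norm (c k - dot (a k) x1 - b k * v); lra.
exists l, (fun k => b k == 0), a, c => y; split.
  move=> /(proper_dom_fin hp)[v yv] k /eqP bk.
  have /E/(_ k) : (h y <= v%:E)%E by rewrite yv.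
  by rewrite bk mul0r addr0.
move=> H; pose s := \sum_k `|(dot (a k) y - c k) / b k|.
suff : (h y <= s%:E)%E by move=> hs; rewrite /dom/=; exact: le_lt_trans hs (ltry _).
apply/E => k; have [bk|bk] := eqVneq (b k) 0.
  by rewrite bk mul0r addr0; apply: H; rewrite bk.
have bk0 : b k < 0 by rewrite lt_neqAle bk b0.
have : - ((dot (a k) y - c k) / b k) <= s.
  apply: (@le_trans _ _ `|(dot (a k) y - c k) / b k|).
    by rewrite -normrN ler_norm.
  by rewrite /s (bigD1 k)//= lerDl sumr_ge0.
rewrite -(ler_nM2l bk0) mulrN mulrCA divff// mulr1; lra.
Qed.

Lemma within_dom_cvg {T : Type} (F : set_system T) (FF : Filter F) h
    (f : T -> V) (r : T -> R) x (v : R) :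
  {within dom h, continuous h} -> f @ F --> x ->
  (\forall t \near F, h (f t) = (r t)%:E) -> h x = v%:E -> r @ F --> v.
Proof.
move=> hc fx fr xv.
have Dx : dom h x by rewrite /dom/= xv ltry.
have fx' : f @ F --> within (dom h) (nbhs x).
  move=> A; rewrite /within/= => wA.
  have /= := fx _ wA; apply: filterS2 fr => t ftr; apply.
  by rewrite /dom/= ftr ltry.
have H1 : f @ F --> (x : subspace (dom h)) by apply/subspace_cvgP.
have H2 : h (f t) @[t --> F] --> h x by exact: (cvg_comp _ _ H1 (hc x)).
have H3 : (r t)%:E @[t --> F] --> v%:E.
  by rewrite -xv; apply: cvg_trans H2; apply: near_eq_cvg;
    apply: filterS fr => t ->.
exact: (fine_cvg H3).
Qed.

Lemma affine_hull_shift (A : set V) x y z (k : R) : A x -> A y -> A z ->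
  affine_hull A (x + k *: (y - z)).
Proof.
move=> Ax Ay Az.
exists 3%N, (fun i => nth 0 [:: x; y; z] i), (fun i => nth 0 [:: 1; k; - k] i).
split.
- by case; case => [|[|[|]]].
- by rewrite !big_ord_recl big_ord0 /=; ring.
- by rewrite !big_ord_recl big_ord0 /= scale1r scaleNr addr0 scalerBr.
Qed.

(* The multipliers [p t] may be unbounded, so the pairing
   [dot (p t) (y t - yi)] is bounded by testing the subgradient inequality at
   a well-chosen point of the domain: [2 y_t - yi] for a polyhedral [h], whose
   domain agrees with its tangent cone near [yi], and [yb + k (y_t - yi)] with
   [k] large when [yb] is a relative interior point. *)
Lemma subgradient_limit {T : Type} (F : set_system T) (FF : ProperFilter F) h
    (p y : T -> V) (r : T -> R) (yi yb : V) (vb c : R) :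
  standing_fun h ->
  (forall t, h (y t) = (r t)%:E) ->
  (forall t, conjugate h (p t) = (dot (p t) (y t) - r t)%:E) ->
  y @ F --> yi -> h yb = vb%:E ->
  (~ polyhedral h -> rel_interior (dom h) yb) ->
  (forall t, vb + (dot (p t) (y t) - r t) - dot (p t) yb <= c) ->
  exists v : R, [/\ h yi = v%:E, r @ F --> v &
    forall d, 0 < d -> \forall t \near F, dot (p t) (y t - yi) <= d].
Proof.
move=> [hp hcv hl hct] yr pc yyi ybv ri bnd.
have [hN _] := hp.
have sub t x v : h x = v%:E -> dot (p t) (x - y t) <= v - r t.
  move=> xv; have : (conjugate h (p t) <= (dot (p t) (y t) - r t)%:E)%E.
    by rewrite pc.
  by move=> /(conjugate_leP _ _ hN)/(_ _ _ xv); rewrite dotBr; lra.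
have Dy t : dom h (y t) by rewrite /dom/= yr ltry.
have yB : (y t - yi) @[t --> F] --> (0 : V).
  by rewrite -(subrr yi); apply: cvgB => //; exact: cvg_cst.
have [pol|npol] := pselect (polyhedral h).
  have [l [P [a [cc domE]]]] := polyhedral_dom hp pol.
  have ay k : dot (a k) (y t) @[t --> F] --> dot (a k) yi.
    by apply: cvg_dot => //; exact: cvg_cst.
  have Dyi : dom h yi.
    apply/domE => k Pk; apply: (cvg_le_near _ (ay k)).
    by apply: filterE => t; have /domE/(_ k Pk) := Dy t.
  have [v yv] := proper_dom_fin hp Dyi.
  have rv : r @ F --> v.
    by apply: (within_dom_cvg _ hct yyi _ yv); apply: filterE.
  exists v; split => // d d0.
  pose z t := y t + (y t - yi).
  have zyi : z @ F --> yi by rewrite -[yi in X in _ --> X]addr0; exact: cvgD.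
  have Dz : \forall t \near F, dom h (z t).
    suff : \forall t \near F, forall k, P k -> dot (a k) (z t) <= cc k.
      by apply: filterS => t Ht; apply/domE.
    apply: filter_forall => k.
    have [Pk|] := boolP (P k); last by move=> _; apply: filterE.
    (* A constraint active at [yi] survives the reflection exactly, as [y t] satisfies it; an
       inactive one holds near [yi] by continuity. *)
    have /domE/(_ k Pk) := Dyi; rewrite le_eqVlt => /orP[/eqP aE|al].
      apply: filterE => t _; have /domE/(_ k Pk) := Dy t.
      by rewrite /z dotDr dotBr; lra.
    have : dot (a k) (z t) @[t --> F] --> dot (a k) yi.
      by apply: cvg_dot => //; exact: cvg_cst.
    by move=> /cvgr_le/(_ _ al); apply: filterS => t ? _.
  have hz : fine (h (z t)) @[t --> F] --> v.
    apply: (within_dom_cvg _ hct zyi _ yv); apply: filterS Dz => t.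
    by move=> /(proper_dom_fin hp)[w ->].
  have hd : (fine (h (z t)) - r t) @[t --> F] --> 0.
    by rewrite -(subrr v); exact: cvgB.
  have hdd : \forall t \near F, fine (h (z t)) - r t <= d.
    exact: (cvgr_le _ hd).
  apply: filterS2 Dz hdd => t.
  move=> /(proper_dom_fin hp)[w wE]; rewrite wE/= => wd.
  have := sub t _ _ wE; rewrite /z addrAC subrr add0r; lra.
have {ri}[_ ri] := ri npol.
have Db : dom h yb by rewrite /dom/= ybv ltry.
have bnd' t x v : h x = v%:E -> dot (p t) (x - yb) <= v - vb + c.
  by move=> xv; have := sub t _ _ xv; have := bnd t; rewrite !dotBr; lra.
have [W ybW WP] : exists2 W : set V, nbhs yb W & forall x, W x ->
    affine_hull (dom h) x -> exists2 v, h x = v%:E & v <= vb + 1.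
  have H : \forall x \near within (dom h) (nbhs yb), (h x <= (vb + 1)%:E)%E.
    have hcvg : h x @[x --> within (dom h) (nbhs yb)] --> vb%:E.
      by rewrite -ybv (nbhs_subspace_in Db); exact: hct.
    have : nbhs vb%:E [set e : \bar R | (e < (vb + 1)%:E)%E].
      apply: open_nbhs_nbhs; split; first exact: open_ereal_lt_ereal.
      by rewrite /= lte_fin ltrDl.
    move=> /hcvg H.
    apply: (@filterS _ (within (dom h) (nbhs yb)) _ _ _ _ H) => x.
    exact: ltW.
  exists ([set x | affine_hull (dom h) x -> dom h x] `&`
          [set x | dom h x -> (h x <= (vb + 1)%:E)%E]); first exact: filterI.
  move=> x [H1 H2] /H1 Dx; have [v xv] := proper_dom_fin hp Dx.
  by exists v => //; have := H2 Dx; rewrite xv lee_fin.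
have Wc t x : W x -> affine_hull (dom h) x -> dot (p t) (x - yb) <= 1 + c.
  by move=> Wx /(WP _ Wx)[v xv v1]; have := bnd' t _ _ xv; lra.
(* A small step from [yb] towards [yi] stays in [W]. The resulting bound on [dot (p t) (y t - yb)]
   bounds [h (y t)], and lower semicontinuity then puts [yi] in the domain. *)
have [k k0 kW] : exists2 k : R, 0 < k & nbhs (yb + k *: (yi - yb)) W.
  have : (yb + k *: (yi - yb)) @[k --> (0 : R)^'+] --> yb + 0 *: (yi - yb).
    apply: cvgD; first exact: cvg_cst.
    by apply: cvgZr_tmp; apply: cvg_at_right_filter; exact: cvg_id.
  rewrite scale0r addr0 => /(_ _ (nbhs_interior ybW)) /= nW.
  have [k [k0 kW]] := filter_ex (filterI (nbhs_right_gt 0) nW).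
  by exists k.
have yk : (yb + k *: (y t - yb)) @[t --> F] --> yb + k *: (yi - yb).
  apply: cvgD; first exact: cvg_cst.
  by apply: cvgZl_tmp; apply: cvgB => //; exact: cvg_cst.
have rb : \forall t \near F, (h (y t) <= (vb + (1 + c) / k)%:E)%E.
  have Wy : \forall t \near F, W (yb + k *: (y t - yb)) := yk _ kW.
  apply: filterS Wy => t Wt; rewrite yr lee_fin.
  have := Wc t _ Wt (affine_hull_shift k Db (Dy t) Db).
  rewrite addrAC subrr add0r dotZr mulrC -ler_pdivlMr// dotBr.
  by have := sub t _ _ ybv; rewrite dotBr; lra.
have Dyi : dom h yi.
  apply: le_lt_trans (ltry (vb + (1 + c) / k)).
  by apply: (lsc_cvg_le _ hl yyi _ rb); exact: cvg_cst.
have [v yv] := proper_dom_fin hp Dyi.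
have rv : r @ F --> v.
  by apply: (within_dom_cvg _ hct yyi _ yv); apply: filterE.
exists v; split => // d d0.
pose K := (`|1 + c| + 1) / d.
have K0 : 0 < K by rewrite divr_gt0// ltr_wpDl.
have : (yb + K *: (y t - yi)) @[t --> F] --> yb + K *: (0 : V).
  by apply: cvgD; [exact: cvg_cst|exact: cvgZl_tmp].
rewrite scaler0 addr0 => yK.
have Wy : \forall t \near F, W (yb + K *: (y t - yi)) := yK _ ybW.
apply: filterS Wy => t Wt.
have := Wc t _ Wt (affine_hull_shift K Db (Dy t) Dyi).
rewrite addrAC subrr add0r dotZr -ler_pdivlMl// => /le_trans; apply.
rewrite ler_pdivrMl//; have -> : K * d = `|1 + c| + 1.
  by rewrite divfK// gt_eqF.
by have := ler_norm (1 + c); lra.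
Qed.

End SubgradientLimits.

(** * The Kullback-Leibler divergence of nonnegative numbers *)

Section KullbackLeibler.
Context {R : realType}.
Implicit Types a b c : R.

(** As [ln 0 = 0], the value at [a = 0] is [b], the continuous extension. *)
Definition kl a b := a * ln a - a * ln b - a + b.

Lemma kl_xx a : kl a a = 0.
Proof. by rewrite /kl; ring. Qed.

(** Multiply [ln x <= x - 1] at [x = sqrt b / sqrt a] by [2 * a]. *)
Lemma sqr_sqrtB_le_kl a b :
  0 <= a -> 0 < b -> (Num.sqrt a - Num.sqrt b) ^+ 2 <= kl a b.
Proof.
rewrite le_eqVlt => /predU1P[<- b0|a0 b0].
  by rewrite sqrtr0 sub0r sqrrN sqr_sqrtr ?(ltW b0)// /kl !mul0r !subr0 add0r.
rewrite /kl -{2 3 4 5}[a]sqr_sqrtr ?(ltW a0)// -{2 3}[b]sqr_sqrtr ?(ltW b0)//.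
have := a0; have := b0; rewrite -sqrtr_gt0 => B0; rewrite -sqrtr_gt0 => A0.
move: (Num.sqrt a) (Num.sqrt b) A0 B0 => A B A0 B0.
rewrite !lnXn// !mulr2n.
have BA : 0 < B / A by rewrite divr_gt0.
have : ln (B / A) <= B / A - 1.
  rewrite -[X in ln X](subrK 1) addrC; apply: le_ln1Dx; lra.
rewrite ln_div// -(ler_pM2l (exprn_gt0 2 A0)).
have -> : A ^+ 2 * (B / A - 1) = A * B - A ^+ 2 by field; rewrite gt_eqF.
by lra.
Qed.

Lemma kl_ge0 a b : 0 <= a -> 0 < b -> 0 <= kl a b.
Proof. by move=> a0 b0; apply: le_trans (sqr_sqrtB_le_kl a0 b0); rewrite sqr_ge0. Qed.

(** Combine the square-root bound with the nonnegativity of the square of [2 * sqrt a - sqrt b]. *)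
Lemma le_kl_bound a b c : 0 <= a -> 0 < b -> kl a b <= c -> b <= 2 * a + 2 * c.
Proof.
move=> a0 b0 /(le_trans (sqr_sqrtB_le_kl a0 b0)).
rewrite -{2}[a]sqr_sqrtr// -{2}[b]sqr_sqrtr ?(ltW b0)//.
by have := sqr_ge0 (2 * Num.sqrt a - Num.sqrt b); nra.
Qed.

Lemma cvg_kl0 {T : Type} (F : set_system T) (FF : Filter F) (u : T -> R) a :
  0 <= a -> u @ F --> a -> kl a (u t) @[t --> F] --> 0.
Proof.
rewrite le_eqVlt => /predU1P[<- ul|a0 ul].
  by rewrite /kl; under eq_fun do rewrite !mul0r !subr0 add0r.
rewrite -(kl_xx a) /kl; apply: cvgD => //; apply: cvgB; last exact: cvg_cst.
apply: cvgB; first exact: cvg_cst.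
apply: cvgM; first exact: cvg_cst.
exact: (cvg_comp _ _ ul (continuous_ln a0)).
Qed.

Lemma kl_limit_eq {T : Type} (F : set_system T) (FF : ProperFilter F)
    (u : T -> R) (a l : R) : 0 <= a -> 0 <= l -> (forall t, 0 < u t) -> u @ F --> l ->
  (forall d, 0 < d -> \forall t \near F, kl a (u t) <= d) -> a = l.
Proof.
move=> a0 l0 u0 ul kd.
have H : (Num.sqrt a - Num.sqrt (u t)) ^+ 2 @[t --> F] -->
    (Num.sqrt a - Num.sqrt l) ^+ 2.
  have S : (Num.sqrt a - Num.sqrt (u t)) @[t --> F] --> Num.sqrt a - Num.sqrt l.
    apply: cvgB; first exact: cvg_cst.
    exact: (cvg_comp _ _ ul (@sqrt_continuous _ l)).
  by rewrite expr2; under eq_fun do rewrite expr2; exact: cvgM.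
have : (Num.sqrt a - Num.sqrt l) ^+ 2 <= 0.
  apply/ler_addgt0Pl => d d0; rewrite addr0.
  apply: (cvg_le_near _ H); apply: filterS (kd d d0) => t.
  exact: le_trans (sqr_sqrtB_le_kl a0 (u0 t)).
rewrite exprn_even_le0//= subr_eq0 => /eqP.
by move=> /(congr1 (fun x => x ^+ 2)); rewrite !sqr_sqrtr.
Qed.

Lemma cvg_of_sqrt_close {T : Type} (F : set_system T) (FF : Filter F)
    (u w : T -> R) a : (forall t, 0 <= w t) -> 0 <= a ->
  u @ F --> a -> (Num.sqrt (w t) - Num.sqrt (u t)) @[t --> F] --> 0 ->
  w @ F --> a.
Proof.
move=> w0 a0 ul wu.
have su : Num.sqrt (u t) @[t --> F] --> Num.sqrt a.
  exact: (cvg_comp _ _ ul (@sqrt_continuous _ a)).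
have sw : Num.sqrt (w t) @[t --> F] --> Num.sqrt a.
  have : (Num.sqrt (w t) - Num.sqrt (u t) + Num.sqrt (u t)) @[t --> F] -->
    0 + Num.sqrt a by exact: cvgD.
  by under eq_fun do rewrite subrK; rewrite add0r.
have : (Num.sqrt (w t) * Num.sqrt (w t)) @[t --> F] -->
  Num.sqrt a * Num.sqrt a by exact: cvgM.
by under eq_fun do rewrite -expr2 sqr_sqrtr//; rewrite -expr2 sqr_sqrtr.
Qed.

End KullbackLeibler.

(** * Exact block ascent for an entropic dual problem with a finite family of blocks *)

Section BlockAscent.
Context {R : realType} {I B : finType} {m n : B -> nat}.
Context (pi : forall b, I -> 'I_(m b) * 'I_(n b)) (K : I -> R) (eps : R)
  (h : forall b, 'M[R]_(m b, n b) -> \bar R).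
Local Arguments h : clear implicits.
Local Notation dblocks := (forall b : B, 'M[R]_(m b, n b)).
Implicit Types (l : dblocks) (M : I -> R) (b : B).

(** [pi b] sends a multi-index to the entry of block [b] it contributes to, so that marginals and
    bimarginals are both instances. *)
Definition pushfwd b M : 'M[R]_(m b, n b) :=
  \matrix_(a, c) \sum_(i | pi b i == (a, c)) M i.

Definition potential l i : R := \sum_b l b (pi b i).1 (pi b i).2.

Definition gibbs_of l i : R := K i * expR (eps^-1 * potential l i).

Definition dual_finite l : Prop :=
  forall b, conjugate (h b) (- l b) \is a fin_num.

(* Meaningful only for [dual_finite l], as [fine] sends infinities to 0. *)
Definition dual_value l : R :=
  - eps * (\sum_i gibbs_of l i) - \sum_b fine (conjugate (h b) (- l b)).

Definition primal_finite M : Prop :=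
  (forall i, 0 <= M i) /\ (forall b, dom (h b) (pushfwd b M)).

Definition entropic_cost M : R :=
  \sum_i (- eps * ln (K i) * M i + eps * (M i * ln (M i) - M i + 1)).

Definition primal_value M : R :=
  entropic_cost M + \sum_b fine (h b (pushfwd b M)).

(** Fermat's rule for maximizing the dual value over block [b]: the marginal of [gibbs_of l'] is the
    gradient of its scaled total mass with respect to that block. *)
Definition block_step b l l' : Prop :=
  (forall b', b' != b -> l' b' = l b') /\
  subdifferential (conjugate (h b)) (- l' b) (pushfwd b (gibbs_of l')).

Fixpoint block_pass (order : seq B) l l' : Prop :=
  match order with
  | [::] => l' = l
  | b :: order' => exists2 z, block_step b l z & block_pass order' z l'
  end.

Hypothesis K_gt0 : forall i, 0 < K i.
Hypothesis eps_gt0 : 0 < eps.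
Hypothesis h_standing : forall b, standing_fun (h b).

Let h_proper b : proper_fun (h b). Proof. by have [] := h_standing b. Qed.
Let eps_neq0 : eps != 0. Proof. by rewrite gt_eqF. Qed.

Lemma dot_pushfwd b (L : 'M[R]_(m b, n b)) M :
  dot L (pushfwd b M) = \sum_i L (pi b i).1 (pi b i).2 * M i.
Proof.
rewrite /dot pair_big (partition_big (pi b) predT)//=.
apply: eq_bigr => -[a c] _ /=; rewrite mxE mulr_sumr.
by apply: eq_bigr => i /eqP ->.
Qed.

Lemma sum_dot_pushfwd l M :
  \sum_b dot (l b) (pushfwd b M) = \sum_i potential l i * M i.
Proof.
under eq_bigr do rewrite dot_pushfwd.
by rewrite exchange_big; apply: eq_bigr => i _; rewrite mulr_suml.
Qed.

Lemma gibbs_of_gt0 l i : 0 < gibbs_of l i.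
Proof. by rewrite mulr_gt0 ?expR_gt0. Qed.

Lemma ln_gibbs_of l i : ln (gibbs_of l i) = ln (K i) + eps^-1 * potential l i.
Proof. by rewrite lnM ?posrE ?expR_gt0// expRK. Qed.

Lemma potentialE l i : potential l i = eps * (ln (gibbs_of l i) - ln (K i)).
Proof. by rewrite ln_gibbs_of addrAC subrr add0r mulrA divff// mul1r. Qed.

(** The Fenchel-Young gap of [h b] between [pushfwd b M] and [- L]. *)
Definition block_gap b (L : 'M[R]_(m b, n b)) M : R :=
  fine (h b (pushfwd b M)) + fine (conjugate (h b) (- L)) +
  dot L (pushfwd b M).

Lemma block_gap_ge0 b (L : 'M[R]_(m b, n b)) M : dom (h b) (pushfwd b M) ->
  conjugate (h b) (- L) \is a fin_num -> 0 <= block_gap L M.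
Proof.
move=> /(proper_dom_fin (h_proper b))[v hv] /fineK cE.
have : (conjugate (h b) (- L) <= (fine (conjugate (h b) (- L)))%:E)%E.
  by rewrite cE.
move=> /(conjugate_leP _ _ (h_proper b).1)/(_ _ _ hv).
by rewrite /block_gap hv dotNl /=; lra.
Qed.

(** Replacing [ln (K i)] by [ln (gibbs_of l i) - eps^-1 * potential l i] completes the entropy to a
    divergence. The constant [eps *+ #|I|] collects the [+ 1] of the entropy terms. *)
Lemma entropic_cost_gibbs l M : entropic_cost M =
  eps * (\sum_i kl (M i) (gibbs_of l i)) + \sum_b dot (l b) (pushfwd b M)
  - eps * (\sum_i gibbs_of l i) + eps *+ #|I|.
Proof.
have -> : eps *+ #|I| = \sum_(i : I) eps by rewrite sumr_const.
rewrite sum_dot_pushfwd !mulr_sumr -big_split -sumrB -big_split /=.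
by apply: eq_bigr => i _; rewrite potentialE /kl; ring.
Qed.

Lemma duality_gap l M : primal_value M - dual_value l =
  eps * (\sum_i kl (M i) (gibbs_of l i)) + \sum_b block_gap (l b) M
  + eps *+ #|I|.
Proof.
rewrite /primal_value (entropic_cost_gibbs l) /dual_value /block_gap.
by rewrite !big_split /=; ring.
Qed.

Lemma sum_kl_ge0 l M : (forall i, 0 <= M i) ->
  0 <= \sum_i kl (M i) (gibbs_of l i).
Proof.
by move=> M0; apply: sumr_ge0 => i _; rewrite kl_ge0// gibbs_of_gt0.
Qed.

Lemma weak_duality l M : primal_finite M -> dual_finite l ->
  dual_value l + eps *+ #|I| <= primal_value M.
Proof.
move=> [M0 MD] lf; have := duality_gap l M.
have : 0 <= eps * (\sum_i kl (M i) (gibbs_of l i)).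
  by rewrite mulr_ge0 ?sum_kl_ge0// ltW.
have : 0 <= \sum_b block_gap (l b) M.
  by apply: sumr_ge0 => b _; apply: block_gap_ge0.
lra.
Qed.

Lemma block_step_subgradient b l l' : block_step b l l' ->
  exists r : R, h b (pushfwd b (gibbs_of l')) = r%:E /\
    conjugate (h b) (- l' b) =
      (dot (- l' b) (pushfwd b (gibbs_of l')) - r)%:E.
Proof.
move=> [_ sd]; have [hp hc hl _] := h_standing b.
exact: subdifferential_conjugate.
Qed.

Lemma block_step_finite b l l' :
  block_step b l l' -> dual_finite l -> dual_finite l'.
Proof.
move=> st lf b'; have [->|bb'] := eqVneq b' b.
  by have [r [_ ->]] := block_step_subgradient st.
by rewrite st.1.
Qed.

(** Test the subgradient inequality at the old multiplier. Only block [b] changes, so the pairing is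
    the difference of potentials, and the gain is at least [eps] times the divergence of the new
    tensor from the old. *)
Lemma block_step_gain b l l' : block_step b l l' -> dual_finite l ->
  eps * (\sum_i (Num.sqrt (gibbs_of l i) - Num.sqrt (gibbs_of l' i)) ^+ 2) <=
  dual_value l' - dual_value l.
Proof.
move=> st lf; have l'f := block_step_finite st lf.
have [same sd] := st.
have := sd (- l b); rewrite -(fineK (lf b)) -(fineK (l'f b)) lee_fin.
rewrite opprK dotC dot_pushfwd => gain.
have -> : dual_value l' - dual_value l =
    eps * (\sum_i gibbs_of l i) - eps * (\sum_i gibbs_of l' i) +
    (fine (conjugate (h b) (- l b)) - fine (conjugate (h b) (- l' b))).
  rewrite /dual_value [X in _ - X - _](bigD1 b)//= [X in _ - (_ - X)](bigD1 b)//=.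
  rewrite (eq_bigr (fun j => fine (conjugate (h j) (- l j)))); first by ring.
  by move=> b' bb'; rewrite same.
set S := \sum_i _ in gain.
have SE : S = \sum_i gibbs_of l' i *
    (eps * ln (gibbs_of l' i) - eps * ln (gibbs_of l i)).
  apply: eq_bigr => i _; rewrite !mxE mulrC; congr (_ * _).
  transitivity (potential l' i - potential l i); last first.
    by rewrite !potentialE; ring.
  rewrite /potential (bigD1 b)//= [X in _ - X](bigD1 b)//=.
  rewrite (eq_bigr (fun j => l j (pi j i).1 (pi j i).2)); first by ring.
  by move=> b' bb'; rewrite same.
suff : eps * (\sum_i (Num.sqrt (gibbs_of l i) - Num.sqrt (gibbs_of l' i)) ^+ 2)
    <= eps * (\sum_i gibbs_of l i) - eps * (\sum_i gibbs_of l' i) + S.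
  by move: gain; lra.
rewrite SE !mulr_sumr -sumrB -big_split/=; apply: ler_sum => i _.
have := sqr_sqrtB_le_kl (ltW (gibbs_of_gt0 l' i)) (gibbs_of_gt0 l i).
by move=> /(ler_wpM2l (ltW eps_gt0)); rewrite /kl; lra.
Qed.

Lemma sqr_le_abs_le_sqrt (a c : R) : a ^+ 2 <= c -> `|a| <= Num.sqrt c.
Proof. by move=> ac; rewrite -sqrtr_sqr ler_wsqrtr. Qed.

(** In the last clause [z] is the state right after the update of [b]. As [order] has no repetition,
    block [b] keeps that value until the end of the pass. Each step moves the square roots by at
    most the root of its gain over [eps]; the triangle inequality gives the factor [size order]. *)
Lemma block_pass_spec order l l' : uniq order -> block_pass order l l' ->
  [/\ forall b, b \notin order -> l' b = l b,
      dual_finite l -> [/\ dual_finite l', dual_value l <= dual_value l' &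
        forall i, `|Num.sqrt (gibbs_of l i) - Num.sqrt (gibbs_of l' i)| <=
          (size order)%:R * Num.sqrt ((dual_value l' - dual_value l) / eps)]
    & forall b, b \in order -> exists z (r : R),
      [/\ h b (pushfwd b (gibbs_of z)) = r%:E,
          conjugate (h b) (- l' b) =
            (dot (- l' b) (pushfwd b (gibbs_of z)) - r)%:E
        & dual_finite l ->
          forall i, `|Num.sqrt (gibbs_of z i) - Num.sqrt (gibbs_of l' i)| <=
          (size order)%:R * Num.sqrt ((dual_value l' - dual_value l) / eps)]].
Proof.
elim: order l => [l _ /= ->|b o IH l /= /andP[bo uo] [z st pz]].
  by split=> // lf; split=> // i; rewrite subrr normr0 mul0r.
have [same fin sg] := IH _ uo pz.
have gain := block_step_gain st.
have lz (lf : dual_finite l) : dual_value l <= dual_value z.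
  rewrite -subr_ge0; apply: le_trans (gain lf).
  by rewrite mulr_ge0 ?(ltW eps_gt0)//; apply: sumr_ge0 => i _; rewrite sqr_ge0.
have mono (lf : dual_finite l) :
    Num.sqrt ((dual_value l' - dual_value z) / eps) <=
    Num.sqrt ((dual_value l' - dual_value l) / eps).
  by rewrite ler_wsqrtr// ler_pM2r ?invr_gt0// lerB// lz.
have bound (lf : dual_finite l) (a : R) : a <=
    (size o)%:R * Num.sqrt ((dual_value l' - dual_value z) / eps) ->
    a <= (size o)%:R * Num.sqrt ((dual_value l' - dual_value l) / eps).
  by move=> /le_trans; apply; rewrite ler_wpM2l// mono.
split.
- move=> b'; rewrite inE negb_or => /andP[bb' b'o].
  by rewrite same// st.1.
- move=> lf; have zf := block_step_finite st lf.
  have [l'f zl' cl] := fin zf; split=> //; first exact: le_trans (lz lf) zl'.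
  move=> i; rewrite -natr1 mulrDl mul1r [leRHS]addrC.
  apply: le_trans (ler_distD (Num.sqrt (gibbs_of z i)) _ _) _.
  apply: lerD; last exact/(bound lf)/cl.
  apply: sqr_le_abs_le_sqrt; rewrite ler_pdivlMr// mulrC.
  apply: (@le_trans _ _ (dual_value z - dual_value l)); last by rewrite lerB.
  apply: le_trans (gain lf); rewrite ler_pM2l// (bigD1 i)//= lerDl.
  by apply: sumr_ge0 => j _; rewrite sqr_ge0.
- have weaken (lf : dual_finite l) (a : R) : a <=
      (size o)%:R * Num.sqrt ((dual_value l' - dual_value z) / eps) ->
      a <= (size o).+1%:R * Num.sqrt ((dual_value l' - dual_value l) / eps).
    move=> /(bound lf)/le_trans; apply; rewrite ler_wpM2r ?sqrtr_ge0//.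
    by rewrite ler_nat.
  move=> b'; rewrite inE => /predU1P[->|b'o].
    have [r [hr cr]] := block_step_subgradient st.
    exists z, r; rewrite same//; split=> // lf i; apply: (weaken lf).
    by have [_ _] := fin (block_step_finite st lf); exact.
  have [w [r [hr cr cl]]] := sg _ b'o.
  exists w, r; split=> // lf i; apply: (weaken lf).
  exact: cl (block_step_finite st lf) i.
Qed.

(** * Convergence of dual trajectories with asymptotically exact block optimality *)

Section Trajectory.
(** [w k b] stands for the tensor just after the last update of block [b] before [lam k], and
    [r k b] for the value of [h b] at its marginal. *)
Variables (lam : nat -> dblocks) (w : nat -> B -> I -> R) (r : nat -> B -> R).
Variable Mb : I -> R.
Hypothesis lam_value : forall k b, h b (pushfwd b (w k b)) = (r k b)%:E.
Hypothesis lam_conjugate : forall k b, conjugate (h b) (- lam k b) =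
  (dot (- lam k b) (pushfwd b (w k b)) - r k b)%:E.
Hypothesis dual_value_min : forall k, dual_value (lam 0) <= dual_value (lam k).
Hypothesis w_ge0 : forall k b i, 0 <= w k b i.
Hypothesis w_close : forall b i,
  (Num.sqrt (w k b i) - Num.sqrt (gibbs_of (lam k) i)) @[k --> \oo] --> 0.
Hypothesis Mb_finite : primal_finite Mb.
Hypothesis Mb_ri : forall b, ~ polyhedral (h b) ->
  rel_interior (dom (h b)) (pushfwd b Mb).

Let gap0 := primal_value Mb - dual_value (lam 0).

Lemma trajectory_finite k : dual_finite (lam k).
Proof. by move=> b; rewrite lam_conjugate. Qed.

Let block_gaps_ge0 k b : 0 <= block_gap (lam k b) Mb.
Proof. by apply: block_gap_ge0; [exact: Mb_finite.2|exact: trajectory_finite]. Qed.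

Let eps_card_ge0 : 0 <= eps *+ #|I|.
Proof. by rewrite mulrn_wge0// ltW. Qed.

(** The duality gap against [Mb] never exceeds [gap0] and all its terms are nonnegative, so each
    divergence is at most [gap0 / eps]. *)
Lemma trajectory_bounded k i : gibbs_of (lam k) i <= 2 * Mb i + 2 * (gap0 / eps).
Proof.
have [M0 MD] := Mb_finite.
apply: le_kl_bound; rewrite ?gibbs_of_gt0// ler_pdivlMr// mulrC.
have := duality_gap (lam k) Mb; have := dual_value_min k.
have : 0 <= \sum_b block_gap (lam k b) Mb by exact: sumr_ge0.
have : kl (Mb i) (gibbs_of (lam k) i) <= \sum_i kl (Mb i) (gibbs_of (lam k) i).
  rewrite (bigD1 i)//= lerDl; apply: sumr_ge0 => j _.
  by rewrite kl_ge0// gibbs_of_gt0.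
move=> /(ler_wpM2l (ltW eps_gt0)).
by move: eps_card_ge0; rewrite /gap0; lra.
Qed.

Lemma trajectory_block_gap k b : block_gap (lam k b) Mb <= gap0.
Proof.
have := duality_gap (lam k) Mb; have := dual_value_min k.
have : 0 <= eps * (\sum_i kl (Mb i) (gibbs_of (lam k) i)).
  by rewrite mulr_ge0 ?sum_kl_ge0 ?(ltW eps_gt0)//; exact: Mb_finite.1.
have : block_gap (lam k b) Mb <= \sum_b block_gap (lam k b) Mb.
  by rewrite (bigD1 b)//= lerDl; exact: sumr_ge0.
by move: eps_card_ge0; rewrite /gap0; lra.
Qed.

Lemma trajectory_ultra_limit U : UltraFilter U -> \oo `<=` U ->
  exists (Mi : I -> R) (v : B -> R),
    [/\ forall i, 0 <= Mi i,
        forall i, gibbs_of (lam k) i @[k --> U] --> Mi i,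
        forall b, pushfwd b (w k b) @[k --> U] --> pushfwd b Mi,
        forall b, h b (pushfwd b Mi) = (v b)%:E /\ r k b @[k --> U] --> v b
      & forall b d, 0 < d -> \forall k \near U,
          dot (- lam k b) (pushfwd b (w k b) - pushfwd b Mi) <= d].
Proof.
move=> UU ooU.
have /choice[Mi MiP] : forall i, exists l : R,
    gibbs_of (lam k) i @[k --> U] --> l.
  move=> i; apply: (@ultra_bounded_cvg _ _ _ _ (2 * Mb i + 2 * (gap0 / eps))) => //.
  apply: filterE => k; rewrite ger0_norm ?trajectory_bounded// ltW//.
  exact: gibbs_of_gt0.
have Mi0 i : 0 <= Mi i.
  apply: (cvg_ge_near _ (MiP i)); apply: filterE => k.
  by rewrite ltW// gibbs_of_gt0.
have push b : pushfwd b (w k b) @[k --> U] --> pushfwd b Mi.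
  apply: cvg_mx => a c; rewrite mxE; under eq_fun do rewrite mxE.
  apply: cvg_finsum => i _.
  apply: (@cvg_of_sqrt_close _ _ U _ (fun k => gibbs_of (lam k) i)) => //.
  by move=> A /(w_close b i) H; exact: (ooU _ H).
have lim b : exists v : R, [/\ h b (pushfwd b Mi) = v%:E,
    r k b @[k --> U] --> v & forall d, 0 < d -> \forall k \near U,
      dot (- lam k b) (pushfwd b (w k b) - pushfwd b Mi) <= d].
  have [vb hb] := proper_dom_fin (h_proper b) (Mb_finite.2 b).
  apply: (@subgradient_limit _ _ _ _ U _ (h b) _ _ _ _ (pushfwd b Mb) vb gap0)
    => //; [exact: Mb_ri|move=> k].
  (* The bound that [subgradient_limit] requires is exactly the block gap at [Mb]. *)
  have := trajectory_block_gap k b.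
  by rewrite /block_gap hb lam_conjugate/= !dotNl; lra.
have /choice[v vP] := lim.
by exists Mi, v; split=> // b; have [] := vP b.
Qed.

(** Write the costs of [M] and [Mi] relative to the same [gibbs_of (lam k)] and subtract. The
    divergence of [Mi] tends to 0, and the linear terms are compared blockwise by the subgradient
    inequalities. *)
Lemma trajectory_near_optimal U (Mi : I -> R) (v : B -> R) : UltraFilter U ->
  (forall i, 0 <= Mi i) ->
  (forall i, gibbs_of (lam k) i @[k --> U] --> Mi i) ->
  (forall b, h b (pushfwd b Mi) = (v b)%:E /\ r k b @[k --> U] --> v b) ->
  (forall b d, 0 < d -> \forall k \near U,
    dot (- lam k b) (pushfwd b (w k b) - pushfwd b Mi) <= d) ->
  forall M, primal_finite M -> forall d, 0 < d -> \forall k \near U,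
    primal_value Mi + eps * (\sum_i kl (M i) (gibbs_of (lam k) i)) <=
    primal_value M + d.
Proof.
move=> UU Mi0 MiP vP small M [M0 MD] d d0.
have kl0 : eps * (\sum_i kl (Mi i) (gibbs_of (lam k) i)) @[k --> U] --> 0.
  rewrite -[X in _ --> X](mulr0 eps); apply: cvgM; first exact: cvg_cst.
  have : \sum_i kl (Mi i) (gibbs_of (lam k) i) @[k --> U] --> \sum_(i : I) (0 : R).
    by apply: cvg_finsum => i _; exact: cvg_kl0.
  by have -> : \sum_(i : I) (0 : R) = 0 by rewrite big1.
have r0 : \sum_b (v b - r k b) @[k --> U] --> 0.
  have : \sum_b (v b - r k b) @[k --> U] --> \sum_b (v b - v b).
    apply: cvg_finsum => b _.
    by apply: cvgB; [exact: cvg_cst|exact: (vP b).2].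
  have -> // : \sum_b (v b - v b) = 0.
  by rewrite big1// => b _; rewrite subrr.
(* One third of [d] each goes to the divergence of [Mi], the values [r] and the pairings. The
   successor keeps [d'] positive even without blocks. *)
pose d' := d / 3 / #|B|.+1%:R.
have d3 : 0 < d / 3 by rewrite divr_gt0.
have d'0 : 0 < d' by rewrite divr_gt0.
have H1 : \forall k \near U, eps * (\sum_i kl (Mi i) (gibbs_of (lam k) i)) <= d / 3.
  exact: (cvgr_le _ kl0).
have H2 : \forall k \near U, \sum_b (v b - r k b) <= d / 3.
  exact: (cvgr_le _ r0).
have H3 : \forall k \near U, forall b,
    dot (- lam k b) (pushfwd b (w k b) - pushfwd b Mi) <= d'.
  by apply: filter_forall => b; exact: small.
apply: filterS3 H1 H2 H3 => k H1 H2 H3.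
have eqM := entropic_cost_gibbs (lam k) M.
have eqMi := entropic_cost_gibbs (lam k) Mi.
have sumB : \sum_(b : B) d' <= d / 3.
  rewrite sumr_const -[X in X <= _]mulr_natr /d' -mulrA ler_piMr ?(ltW d3)//.
  by rewrite mulrC ler_pdivrMr// mul1r ler_nat.
suff : \sum_b (v b - fine (h b (pushfwd b M)) + dot (lam k b) (pushfwd b Mi)
    - dot (lam k b) (pushfwd b M)) <= \sum_b (v b - r k b) + \sum_(b : B) d'.
  rewrite !sumrB big_split/= sumrB.
  have vE : \sum_b fine (h b (pushfwd b Mi)) = \sum_b v b.
    by apply: eq_bigr => b _; rewrite (vP b).1.
  by move: H2; rewrite sumrB /primal_value vE; lra.
rewrite -big_split/=; apply: ler_sum => b _.
have [u hu] := proper_dom_fin (h_proper b) (MD b).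
have : (conjugate (h b) (- lam k b) <=
    (dot (- lam k b) (pushfwd b (w k b)) - r k b)%:E)%E by rewrite lam_conjugate.
move=> /(conjugate_leP _ _ (h_proper b).1)/(_ _ _ hu).
by have := H3 b; rewrite hu/= !dotBr !dotNl; lra.
Qed.

(** Every ultrafilter limit is a minimizer. The divergence of any minimizer from the iterates
    becomes arbitrarily small, so it equals that limit; hence all ultrafilter limits agree. *)
Lemma trajectory_limit : exists Mi, [/\ primal_finite Mi,
  forall M, primal_finite M -> primal_value Mi <= primal_value M,
  forall M, primal_finite M -> primal_value M <= primal_value Mi -> M =1 Mi
  & forall i, gibbs_of (lam k) i @[k --> \oo] --> Mi i].
Proof.
have key U : UltraFilter U -> \oo `<=` U -> exists Mi, [/\ primal_finite Mi,
    forall M, primal_finite M -> primal_value Mi <= primal_value M,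
    forall M, primal_finite M -> primal_value M <= primal_value Mi -> M =1 Mi
    & forall i, gibbs_of (lam k) i @[k --> U] --> Mi i].
  move=> UU ooU.
  have [Mi [v [Mi0 MiP _ vP small]]] := trajectory_ultra_limit UU ooU.
  have opt := trajectory_near_optimal UU Mi0 MiP vP small.
  exists Mi; split=> //.
  - by split=> // b; rewrite /dom/= (vP b).1 ltry.
  - move=> M Mf; apply/ler_addgt0Pr => d d0.
    have [k] := filter_ex (opt M Mf d d0); apply: le_trans; rewrite lerDl.
    by rewrite mulr_ge0 ?sum_kl_ge0 ?(ltW eps_gt0)//; exact: Mf.1.
  - move=> M Mf MM i.
    apply: (@kl_limit_eq _ _ U _ (fun k => gibbs_of (lam k) i)) => //.
    + exact: Mf.1.
    + by move=> k; exact: gibbs_of_gt0.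
    + move=> d d0; have ed0 : 0 < eps * d by rewrite mulr_gt0.
      apply: filterS (opt M Mf _ ed0) => k.
      have : kl (M i) (gibbs_of (lam k) i) <= \sum_i kl (M i) (gibbs_of (lam k) i).
        rewrite (bigD1 i)//= lerDl; apply: sumr_ge0 => j _.
        by rewrite kl_ge0 ?gibbs_of_gt0//; exact: Mf.1.
      move=> ? ?; rewrite -(ler_pM2l eps_gt0); nra.
have [U0 [UU0 ooU0]] := ultraFilterLemma (@eventually_filter).
have [Mi [Mf Mopt Muniq _]] := key U0 UU0 ooU0.
exists Mi; split=> // i; apply: ultra_cvg_oo => U UU ooU.
have [M' [Mf' Mopt' _ M'P]] := key U UU ooU.
by rewrite -(Muniq M' Mf' (Mopt' _ Mf) i); exact: M'P.
Qed.

(** When the multipliers converge too, [Mi] is [gibbs_of li] and Fenchel equality passes to the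
    limit. All terms of the duality gap except the constant vanish, and weak duality concludes. *)
Lemma trajectory_dual_cluster U (li : dblocks) : UltraFilter U -> \oo `<=` U ->
  (forall b, lam k b @[k --> U] --> li b) ->
  dual_finite li /\ forall l', dual_finite l' -> dual_value l' <= dual_value li.
Proof.
move=> UU ooU lamP.
have [Mi [v [Mi0 MiP push vP _]]] := trajectory_ultra_limit UU ooU.
have MiE : Mi = gibbs_of li.
  apply/funext => i; have H : gibbs_of (lam k) i @[k --> U] --> gibbs_of li i.
    apply: cvgM; first exact: cvg_cst.
    apply: (continuous_cvg _ (@continuous_expR _ _)).
    apply: cvgM; first exact: cvg_cst.
    by apply: cvg_finsum => b _; exact: cvg_mx_coord.
  exact: (cvg_unique _ (MiP i) H).
have conjE b : conjugate (h b) (- li b) =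
    (dot (- li b) (pushfwd b Mi) - v b)%:E.
  apply/eqP; rewrite eq_le; apply/andP; split; last first.
    by apply: ereal_sup_ubound; exists (pushfwd b Mi); rewrite // (vP b).1.
  apply/(conjugate_leP _ _ (h_proper b).1) => x u xu.
  have L1 : (dot (- lam k b) (pushfwd b (w k b)) - r k b) @[k --> U] -->
      dot (- li b) (pushfwd b Mi) - v b.
    apply: cvgB; last exact: (vP b).2.
    by apply: cvg_dot => //; apply: cvgN; exact: lamP.
  have L2 : (dot (- lam k b) x - u) @[k --> U] --> dot (- li b) x - u.
    apply: cvgB; last exact: cvg_cst.
    by apply: cvg_dot; [apply: cvgN; exact: lamP|exact: cvg_cst].
  rewrite -subr_ge0; apply: (cvg_ge_near _ (cvgB L1 L2)).
  apply: filterE => k; rewrite /= subr_ge0.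
  have : (conjugate (h b) (- lam k b) <=
      (dot (- lam k b) (pushfwd b (w k b)) - r k b)%:E)%E.
    by rewrite lam_conjugate.
  by move=> /(conjugate_leP _ _ (h_proper b).1)/(_ _ _ xu).
split; first by move=> b; rewrite conjE.
move=> l' l'f.
have Mf : primal_finite Mi.
  by split=> // b; rewrite /dom/= (vP b).1 ltry.
have := weak_duality Mf l'f; have := duality_gap li Mi.
rewrite big1; last by move=> i _; rewrite MiE kl_xx.
rewrite big1; first by rewrite mulr0; lra.
move=> b _; rewrite /block_gap conjE (vP b).1 /= dotNl; ring.
Qed.

(** Average the tangent-line bounds at the combination [p]. *)
Lemma expR_convex_comb (a b t : R) : 0 <= t <= 1 ->
  expR ((1 - t) * a + t * b) <= (1 - t) * expR a + t * expR b.
Proof.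
move=> /andP[t0 t1]; set p := (1 - t) * a + t * b.
have below x : expR p * (1 + (x - p)) <= expR x.
  rewrite -[X in _ <= expR X](subrK p) (expRD (x - p)) [leRHS]mulrC ler_pM2l ?expR_gt0//.
  exact: expR_ge1Dx.
have t1' : 0 <= 1 - t by rewrite subr_ge0.
have := ler_wpM2l t0 (below b); have := ler_wpM2l t1' (below a).
have : expR p = (1 - t) * (expR p * (1 + (a - p))) +
    t * (expR p * (1 + (b - p))) by rewrite /p; ring.
lra.
Qed.

(** The l1 norm of the whole family. *)
Definition entry_sum l : R := \sum_b \sum_i \sum_j `|l b i j|.

Lemma entry_sum_ge l b i j : `|l b i j| <= entry_sum l.
Proof.
rewrite /entry_sum (bigD1 b)//= (bigD1 i)//= (bigD1 j)//= -!addrA lerDl.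
rewrite !addr_ge0//; apply: sumr_ge0 => ? _ //; apply: sumr_ge0 => ? _ //.
by apply: sumr_ge0.
Qed.

Lemma entry_sum_ge0 l : 0 <= entry_sum l.
Proof. by do 3 (apply: sumr_ge0 => ? _). Qed.

(* If the iterates were unbounded, the points at a fixed distance [rho] from
   the optimum [ls] in their directions would accumulate, by concavity of the
   dual function, at a dual optimum that is too far away. *)
Lemma trajectory_dual_bounded (ls : dblocks) (c : R) : dual_finite ls ->
  (forall l, dual_finite l -> dual_value ls <= dual_value l ->
    entry_sum l <= c) ->
  exists c', forall k b i j, `|lam k b i j| <= c'.
Proof.
move=> lsf lsbnd; apply: contrapT => unb.
have /choice[f fP] : forall k : nat, exists k', k%:R <= entry_sum (lam k').
  move=> k; apply: contrapT => nk; apply: unb; exists k%:R => k' b i j.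
  apply: (le_trans (entry_sum_ge (lam k') i j)).
  by rewrite leNgt; apply/negP => /ltW H; apply: nk; exists k'.
have [U [UU ooU]] := ultraFilterLemma (@eventually_filter).
(* A point at distance [rho] from [ls] has norm at least [c + 1]. *)
pose rho := c + entry_sum ls + 1.
have c0 : 0 <= c by apply: le_trans (entry_sum_ge0 ls) _; exact: lsbnd.
have rho0 : 0 < rho by rewrite ltr_wpDl// addr_ge0// entry_sum_ge0.
pose D k : dblocks := fun b => lam (f k) b - ls b.
have subaddl (l1 l2 : dblocks) :
    entry_sum (fun b => l1 b - l2 b) <= entry_sum l1 + entry_sum l2.
  rewrite /entry_sum -big_split/=; apply: ler_sum => b _.
  rewrite -big_split/=; apply: ler_sum => i _.
  rewrite -big_split/=; apply: ler_sum => j _.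
  by rewrite !mxE ler_normB.
have Dk k : k%:R - entry_sum ls <= entry_sum (D k).
  have -> : entry_sum (D k) = entry_sum (fun b => - (ls b - lam (f k) b)).
    by do 3 (apply: eq_bigr => ? _); rewrite !mxE opprB.
  suff : entry_sum (lam (f k)) <= entry_sum (D k) + entry_sum ls.
    move=> H; have := le_trans (fP k) H; rewrite lerBlDr.
    congr (_ <= _ + _); do 3 (apply: eq_bigr => ? _).
    by rewrite !mxE opprB.
  rewrite /entry_sum -big_split/=; apply: ler_sum => b _.
  rewrite -big_split/=; apply: ler_sum => i _.
  rewrite -big_split/=; apply: ler_sum => j _.
  by rewrite -{1}[lam (f k) b](subrK (ls b)) mxE ler_normD.
(* Once [D k] is long enough, [ls + t k *: D k] is the point of the segment from [ls] to the iterate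
   at distance [rho] from [ls]. *)
pose t k := rho / entry_sum (D k).
have near_big : \forall k \near U, rho <= entry_sum (D k).
  apply: ooU; have := nbhs_infty_ger (rho + entry_sum ls).
  by apply: filterS => k kb; apply: le_trans (Dk k); rewrite lerBrDr.
have t0 : t k @[k --> U] --> 0.
  apply/cvgr0Pnorm_le => d d0; apply: ooU.
  have := nbhs_infty_ger (rho / d + rho + entry_sum ls).
  apply: filterS => k kb.
  have Dpos : 0 < entry_sum (D k).
    apply: lt_le_trans (Dk k); rewrite subr_gt0; apply: lt_le_trans kb.
    by rewrite ltrDr addr_gt0// divr_gt0.
  rewrite ger0_norm; last by rewrite divr_ge0// ltW.
  rewrite /t ler_pdivrMr// mulrC -ler_pdivrMr//.
  by apply: le_trans (Dk k); rewrite lerBrDr; apply: le_trans kb; lra.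
have t01 : \forall k \near U, 0 <= t k <= 1.
  apply: filterS near_big => k kb.
  have Dpos : 0 < entry_sum (D k) by exact: lt_le_trans kb.
  by rewrite divr_ge0 ?ler_pdivrMr ?mul1r// ltW.
have tD k : entry_sum (D k) * t k <= rho.
  have [->|nz] := eqVneq (entry_sum (D k)) 0; first by rewrite mul0r ltW.
  by rewrite mulrC divfK.
have /choice[dl dlP] : forall p : {b : B & ('I_(m b) * 'I_(n b))%type},
    exists x : R, t k * D k (tag p) (tagged p).1 (tagged p).2 @[k --> U] --> x.
  move=> [b [i j]] /=; apply: (@ultra_bounded_cvg _ _ _ _ rho) => //.
  apply: filterS t01 => k /andP[tk0 _]; rewrite normrM (ger0_norm tk0) mulrC.
  by apply: le_trans (tD k); rewrite ler_wpM2r// entry_sum_ge.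
pose de : dblocks := fun b => \matrix_(i, j) dl (Tagged _ (i, j)).
pose mu : dblocks := fun b => ls b + de b.
have deP b i j : t k * D k b i j @[k --> U] --> de b i j.
  by rewrite mxE; exact: (dlP (Tagged _ (i, j))).
have de_rho : entry_sum de = rho.
  have H : \sum_b \sum_i \sum_j `|t k * D k b i j| @[k --> U] --> entry_sum de.
    do 3 (apply: cvg_finsum => ? _).
    by apply: cvg_norm; exact: deP.
  have H' : \sum_b \sum_i \sum_j `|t k * D k b i j| @[k --> U] --> rho.
    apply: cvg_near_cst; apply: filterS2 t01 near_big => k /andP[tk0 _] kb.
    transitivity (t k * entry_sum (D k)); last first.
      by rewrite divfK// gt_eqF// (lt_le_trans rho0).
    rewrite /entry_sum mulr_sumr; apply: eq_bigr => b _.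
    rewrite mulr_sumr; apply: eq_bigr => i _.
    rewrite mulr_sumr; apply: eq_bigr => j _.
    by rewrite normrM (ger0_norm tk0).
  exact: (cvg_unique _ H H').
pose al b : R := fine (conjugate (h b) (- ls b)).
pose be k b : R := fine (conjugate (h b) (- lam (f k) b)).
have beE k b x u : h b x = u%:E -> dot (- lam (f k) b) x - u <= be k b.
  apply: (conjugate_leP _ _ (h_proper b).1).1.
  by rewrite /be fineK//; exact: trajectory_finite.
have alE b x u : h b x = u%:E -> dot (- ls b) x - u <= al b.
  by apply: (conjugate_leP _ _ (h_proper b).1).1; rewrite /al fineK.
(* The dual values are bounded below and the mass term is nonnegative, which bounds the sum of the
   conjugates. *)
have be_sum k : \sum_b be k b <= - dual_value (lam 0).
  have := dual_value_min (f k); rewrite /dual_value -/(be k).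
  have : 0 <= eps * \sum_i gibbs_of (lam (f k)) i.
    rewrite mulr_ge0 ?(ltW eps_gt0)//; apply: sumr_ge0 => i _.
    by rewrite ltW// gibbs_of_gt0.
  rewrite /be; lra.
have tDb b : t k *: D k b @[k --> U] --> de b.
  by apply: cvg_mx => i j; under eq_fun do rewrite mxE; exact: deP.
have tbe_sum : \forall k \near U, \sum_b t k * be k b <= t k * - dual_value (lam 0).
  apply: filterS t01 => k /andP[tk0 _].
  by rewrite -mulr_sumr ler_wpM2l// be_sum.
have tval0 : t k * - dual_value (lam 0) @[k --> U] --> 0.
  rewrite -(mul0r (- dual_value (lam 0))); apply: cvgM => //; exact: cvg_cst.
(* Testing each conjugate at the marginal of [Mb] bounds the scaled values below; with the bound on
   their sum, each one is bounded and converges along [U]. *)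
have /choice[a aP] : forall b, exists a : R, \forall k \near U, a <= t k * be k b.
  move=> b; have [u hu] := proper_dom_fin (h_proper b) (Mb_finite.2 b).
  set x := pushfwd b Mb in hu.
  have H : (t k * (dot (- ls b) x - u) - dot (t k *: D k b) x) @[k --> U] -->
      0 * (dot (- ls b) x - u) - dot (de b) x.
    apply: cvgB; first by apply: cvgM => //; exact: cvg_cst.
    by apply: cvg_dot; [exact: tDb|exact: cvg_cst].
  rewrite mul0r sub0r in H.
  exists (- dot (de b) x - 1).
  have H' : \forall k \near U, - dot (de b) x - 1 <=
      t k * (dot (- ls b) x - u) - dot (t k *: D k b) x.
    by apply: (cvgr_ge _ H); rewrite ltrBlDr ltrDl.
  apply: filterS2 t01 H' => k /andP[tk0 _] /le_trans; apply.
  have := ler_wpM2l tk0 (beE k _ _ _ hu).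
  by rewrite dotZl /D dotBl !dotNl; lra.
have aP' : \forall k \near U, forall b, a b <= t k * be k b.
  exact: filter_forall.
have /choice[ga gaP] : forall b, exists g : R, t k * be k b @[k --> U] --> g.
  move=> b; apply: (@ultra_bounded_cvg _ _ _ _ (1 + \sum_b `|a b|)) => //.
  have t1 : \forall k \near U, t k * - dual_value (lam 0) <= 1.
    exact: (cvgr_le _ tval0).
  apply: filterS3 tbe_sum t1 aP' => k le1 le2 al_.
  have ab : - a b <= \sum_b `|a b|.
    apply: (@le_trans _ _ `|a b|); first by rewrite -normrN ler_norm.
    by rewrite (bigD1 b)//= lerDl; exact: sumr_ge0.
  have oth : - (\sum_(b' | b' != b) t k * be k b') <= \sum_b `|a b|.
    rewrite -sumrN [leRHS](bigD1 b)//= ler_wpDl//; apply: ler_sum => b' _.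
    by apply: (@le_trans _ _ (- a b')); rewrite ?lerN2// -normrN ler_norm.
  rewrite (bigD1 b)//= in le1.
  by apply/ler_normlP; split; have := al_ b; lra.
have ga0 : \sum_b ga b <= 0.
  have H : \sum_b t k * be k b @[k --> U] --> \sum_b ga b.
    by apply: cvg_finsum => b _; exact: gaP.
  rewrite -[leLHS]subr0.
  apply: (cvg_le_near _ (cvgB H tval0)).
  by apply: filterS tbe_sum => k; rewrite /= subr_le0.
(* Convexity along the segment and lower semicontinuity of the conjugate, both obtained by testing
   one point [x] at a time. *)
have muc b : (conjugate (h b) (- mu b) <= (al b + ga b)%:E)%E.
  apply/(conjugate_leP _ _ (h_proper b).1) => x u xu.
  have L1 : ((1 - t k) * al b + t k * be k b) @[k --> U] -->
      (1 - 0) * al b + ga b.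
    apply: cvgD; last exact: gaP.
    apply: cvgM; last exact: cvg_cst.
    by apply: cvgB => //; exact: cvg_cst.
  have L2 : (dot (- ls b) x - u - dot (t k *: D k b) x) @[k --> U] -->
      dot (- ls b) x - u - dot (de b) x.
    apply: cvgB; first exact: cvg_cst.
    by apply: cvg_dot; [exact: tDb|exact: cvg_cst].
  have -> : dot (- mu b) x - u = dot (- ls b) x - u - dot (de b) x.
    by rewrite /mu !dotNl dotDl; ring.
  rewrite -[al b]mul1r -[X in X * al b]subr0 -subr_ge0.
  apply: (cvg_ge_near _ (cvgB L1 L2)).
  apply: filterS t01 => k /andP[tk0 tk1]; rewrite /= subr_ge0.
  have tk1' : 0 <= 1 - t k by rewrite subr_ge0.
  have := ler_wpM2l tk0 (beE k _ _ _ xu).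
  have := ler_wpM2l tk1' (alE _ _ _ xu).
  by rewrite dotZl /D dotBl !dotNl; lra.
have muf : dual_finite mu.
  move=> b; have := muc b; rewrite fin_numE conjugate_neqNy//=.
  by case: (conjugate _ _).
(* By convexity of the exponential; the tensors of the iterates are bounded and their weight [t k]
   tends to 0. *)
have gmu i : gibbs_of mu i <= gibbs_of ls i.
  pose C := 2 * Mb i + 2 * (gap0 / eps).
  have potE k : potential (fun b => ls b + t k *: D k b) i =
      (1 - t k) * potential ls i + t k * potential (lam (f k)) i.
    rewrite /potential !mulr_sumr -big_split; apply: eq_bigr => b _.
    by rewrite !mxE /=; ring.
  have L1 : gibbs_of (fun b => ls b + t k *: D k b) i @[k --> U] --> gibbs_of mu i.
    apply: cvgM; first exact: cvg_cst.
    apply: (continuous_cvg _ (@continuous_expR _ _)).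
    apply: cvgM; first exact: cvg_cst.
    apply: cvg_finsum => b _; apply: cvg_mx_coord.
    by apply: cvgD; [exact: cvg_cst|exact: tDb].
  have L2 : ((1 - t k) * gibbs_of ls i + t k * C) @[k --> U] -->
      (1 - 0) * gibbs_of ls i + 0 * C.
    apply: cvgD; apply: cvgM => //; try exact: cvg_cst.
    by apply: cvgB => //; exact: cvg_cst.
  rewrite subr0 mul1r mul0r addr0 in L2.
  rewrite -subr_ge0; apply: (cvg_ge_near _ (cvgB L2 L1)).
  apply: filterS t01 => k /andP[tk0 tk1]; rewrite /= subr_ge0.
  apply: (@le_trans _ _ ((1 - t k) * gibbs_of ls i + t k * gibbs_of (lam (f k)) i)).
    rewrite /gibbs_of potE mulrDr ![eps^-1 * (_ * _)]mulrCA.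
    rewrite ![_ * (K i * _)]mulrCA -mulrDr ler_pM2l//.
    by apply: expR_convex_comb; rewrite tk0.
  by rewrite lerD2l ler_wpM2l// trajectory_bounded.
have : dual_value ls <= dual_value mu.
  have : eps * (\sum_i gibbs_of mu i) <= eps * (\sum_i gibbs_of ls i).
    by rewrite ler_pM2l//; exact: ler_sum.
  have : \sum_b fine (conjugate (h b) (- mu b)) <= \sum_b al b + \sum_b ga b.
    rewrite -big_split; apply: ler_sum => b _ /=.
    by rewrite -lee_fin fineK ?muf.
  by rewrite /dual_value /al in ga0 *; lra.
(* [mu] is as good as [ls], so its norm is at most [c], yet its distance [rho] to [ls] exceeds
   [c + entry_sum ls]. *)
move=> /(lsbnd _ muf) muc'.
have := subaddl mu ls.
have -> : entry_sum (fun b => mu b - ls b) = entry_sum de.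
  by do 3 (apply: eq_bigr => ? _); rewrite /mu addrAC subrr add0r.
by rewrite de_rho /rho; lra.
Qed.

End Trajectory.

(** * Block ascent sequences as trajectories *)

Section Iterates.
Variables (order : seq B) (l : nat -> dblocks) (Mb : I -> R).
Hypothesis order_uniq : uniq order.
Hypothesis order_full : forall b, b \in order.
Hypothesis l_pass : forall k, block_pass order (l k) (l k.+1).
Hypothesis Mb_finite : primal_finite Mb.
Hypothesis Mb_ri : forall b, ~ polyhedral (h b) ->
  rel_interior (dom (h b)) (pushfwd b Mb).

(** Each block is updated once in the pass, which makes its conjugate finite whatever the starting
    point. *)
Lemma iterates_finite k : dual_finite (l k.+1).
Proof.
move=> b; have [_ _ sg] := block_pass_spec order_uniq (l_pass k).
by have [z [r [_ -> _]]] := sg b (order_full b).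
Qed.

(* The first two iterates are replaced by [l 2]: the dual value is
   only known to be finite from the first iterate on. *)
Let lam k : dblocks := l (k - 2).+2.

(** The dual values increase and are bounded by weak duality, so the gain of a pass tends to 0 and
    its intermediate tensors approach the final one. *)
Lemma iterates_trajectory : exists (w : nat -> B -> I -> R) (r : nat -> B -> R),
  [/\ forall k b, h b (pushfwd b (w k b)) = (r k b)%:E,
      forall k b, conjugate (h b) (- lam k b) =
        (dot (- lam k b) (pushfwd b (w k b)) - r k b)%:E,
      forall k, dual_value (lam 0) <= dual_value (lam k),
      forall k b i, 0 <= w k b i
    & forall b i, (Num.sqrt (w k b i) - Num.sqrt (gibbs_of (lam k) i))
        @[k --> \oo] --> 0].
Proof.
pose d k := dual_value (l k.+1).
have spec k := block_pass_spec order_uniq (l_pass k.+1).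
have dS k : d k <= d k.+1.
  by have [_ fin _] := spec k; have [] := fin (iterates_finite k).
have d_mono : {homo d : a c / (a <= c)%N >-> a <= c}.
  by apply: homo_leq => //; exact: le_trans.
pose e k := (size order)%:R * Num.sqrt ((d k.+1 - d k) / eps).
have e0 : e k @[k --> \oo] --> 0.
  have dc : cvgn d.
    apply: nondecreasing_is_cvgn => //; exists (primal_value Mb) => _ [k _ <-].
    have := weak_duality Mb_finite (iterates_finite k).
    have : 0 <= eps *+ #|I| by rewrite mulrn_wge0// ltW.
    by rewrite /d; lra.
  have [L dL] : exists L : R, d @ \oo --> L by apply/cvg_ex.
  have dSL : d k.+1 @[k --> \oo] --> L by rewrite (cvg_shiftS d).
  have H : (d k.+1 - d k) / eps @[k --> \oo] --> (L - L) / eps.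
    by apply: cvgM; [exact: cvgB|exact: cvg_cst].
  rewrite subrr mul0r in H.
  rewrite -(mulr0 (size order)%:R); apply: cvgM; first exact: cvg_cst.
  rewrite -[X in _ --> X](sqrtr0 R).
  exact: (cvg_comp _ _ H (@sqrt_continuous _ 0)).
have /choice[zr zrP] : forall kb : nat * B, exists zr : dblocks * R,
    [/\ h kb.2 (pushfwd kb.2 (gibbs_of zr.1)) = zr.2%:E,
        conjugate (h kb.2) (- l kb.1.+2 kb.2) =
          (dot (- l kb.1.+2 kb.2) (pushfwd kb.2 (gibbs_of zr.1)) - zr.2)%:E
      & forall i, `|Num.sqrt (gibbs_of zr.1 i) - Num.sqrt (gibbs_of (l kb.1.+2) i)|
          <= e kb.1].
  move=> [k b] /=; have [_ _ sg] := spec k.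
  have [z [r [H1 H2 H3]]] := sg b (order_full b).
  by exists (z, r); split=> //; exact: H3 (iterates_finite k).
(* Index [k - 2] of [zr] refers to the pass from [l (k - 2).+1] to [l (k - 2).+2], that is, the one
   ending at [lam k]. *)
exists (fun k b => gibbs_of (zr ((k - 2)%N, b)).1), (fun k b => (zr ((k - 2)%N, b)).2).
split.
- by move=> k b; have [] := zrP ((k - 2)%N, b).
- by move=> k b; have [] := zrP ((k - 2)%N, b).
- by move=> k; exact: (d_mono 1%N (k - 2).+1).
- by move=> k b i; rewrite ltW// gibbs_of_gt0.
- move=> b i; rewrite -(cvg_shiftn 2); apply/cvgr0Pnorm_le => de de0.
  have : \forall k \near \oo, `|e k| <= de by apply: (cvgr0_norm_le _ e0).
  apply: filterS => k; apply: le_trans; rewrite /lam /= addnK.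
  have [_ _ /(_ i) /le_trans] := zrP (k, b); apply; exact: ler_norm.
Qed.

Let lamE k : lam k.+2 = l k.+2.
Proof. by rewrite /lam subn2. Qed.

Lemma block_ascent_primal : exists Mi, [/\ primal_finite Mi,
  forall M, primal_finite M -> primal_value Mi <= primal_value M,
  forall M, primal_finite M -> primal_value M <= primal_value Mi -> M =1 Mi
  & forall i, gibbs_of (l k) i @[k --> \oo] --> Mi i].
Proof.
have [w [r [H1 H2 H3 H4 H5]]] := iterates_trajectory.
have [Mi [? ? ? MiP]] := trajectory_limit H1 H2 H3 H4 H5 Mb_finite Mb_ri.
exists Mi; split=> // i; apply: cvg_trans (MiP i); apply: near_eq_cvg.
by exists 2%N => // -[|[|k]] //= _; rewrite lamE.
Qed.

Lemma block_ascent_dual_bounded (ls : dblocks) (c : R) : dual_finite ls ->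
  (forall l', dual_finite l' -> dual_value ls <= dual_value l' ->
    entry_sum l' <= c) ->
  exists c', forall k b i j, `|l k b i j| <= c'.
Proof.
move=> lsf lsbnd.
have [w [r [H1 H2 H3 H4 H5]]] := iterates_trajectory.
have [c' c'P] := trajectory_dual_bounded H2 H3 Mb_finite lsf lsbnd.
(* The trajectory starts at [l 2], so the first two iterates are bounded separately. *)
exists (c' + entry_sum (l 0) + entry_sum (l 1)) => k b i j.
have := entry_sum_ge (l 0) i j; have := entry_sum_ge (l 1) i j.
have := c'P 2%N b i j; rewrite lamE.
have := normr_ge0 (l 2 b i j); have := normr_ge0 (l 0 b i j).
have := normr_ge0 (l 1 b i j).
case: k => [|[|k]]; [lra|lra|].
by have := c'P k.+2 b i j; rewrite lamE; lra.
Qed.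

Lemma block_ascent_dual_cluster U (li : dblocks) : UltraFilter U -> \oo `<=` U ->
  (forall b, l k b @[k --> U] --> li b) ->
  dual_finite li /\ forall l', dual_finite l' -> dual_value l' <= dual_value li.
Proof.
move=> UU ooU lP.
have [w [r [H1 H2 H3 H4 H5]]] := iterates_trajectory.
apply: (trajectory_dual_cluster H1 H2 H3 H4 H5 Mb_finite Mb_ri UU ooU) => b.
apply: cvg_trans (lP b); apply: near_eq_cvg; apply: ooU.
by exists 2%N => // -[|[|k]] //= _; rewrite lamE.
Qed.

End Iterates.

End BlockAscent.

(** * Pointwise convergence, cluster points and the maximum norm *)

Section Topology.
Context {R : realType}.

Lemma cvg_ptws {T : Type} (F : set_system T) (FF : Filter F) {U : Type}
    {V : topologicalType} (f : T -> {ptws U -> V}) (l : {ptws U -> V}) :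
  (forall u, f t u @[t --> F] --> l u) -> f @ F --> l.
Proof.
move=> H; apply/cvg_sup => u A [B] [[W] oW <-] Wl BA.
apply: (filterS BA); apply: (H u); apply: open_nbhs_nbhs; split => //.
Qed.

Lemma cvg_ptws_coord {T : Type} (F : set_system T) (FF : Filter F) {U : eqType}
    {V : topologicalType} (f : T -> {ptws U -> V}) (l : {ptws U -> V}) u :
  f @ F --> l -> f t u @[t --> F] --> l u.
Proof.
by move=> fl; exact: (cvg_comp _ _ fl (@proj_continuous U (fun=> V) u l)).
Qed.

(** At a cluster point, the sets of a tail intersected with the preimage of a neighbourhood of [p]
    generate a proper filter; take an ultrafilter above it. *)
Lemma cluster_ultra {V : topologicalType} (u : nat -> V) (p : V) :
  cluster (u @ \oo) p ->
  exists2 U, UltraFilter U & \oo `<=` U /\ u @ U --> p.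
Proof.
move=> clp.
pose G := filter_from [set AB : set nat * set V | \oo AB.1 /\ nbhs p AB.2]
  (fun AB => AB.1 `&` u @^-1` AB.2).
have PG : ProperFilter G.
  apply: filter_from_proper.
    apply: filter_from_filter.
      by exists (setT, setT); split; exact: filterT.
    move=> [A1 B1] [A2 B2] [/= a1 b1] [/= a2 b2].
    exists (A1 `&` A2, B1 `&` B2) => /=; first by split; exact: filterI.
    by move=> t [[? ?] [? ?]]; split; split.
  move=> [A B] [/= Aoo Bp].
  have uA : (u @ \oo) (u @` A).
    by apply: filterS Aoo => t At; exists t.
  have [_ [[t At <-] But]] := clp _ _ uA Bp.
  by exists t.
have [U [UU GU]] := ultraFilterLemma PG.
exists U => //; split=> A AP; apply: GU.
  by exists (A, setT); [split=> //; exact: filterT|move=> t []].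
by exists (setT, A); [split=> //; exact: filterT|move=> t []].
Qed.

Lemma entry_le_mx_norm {m n : nat} (x : 'M[R]_(m, n)) i j : `|x i j| <= `|x|.
Proof.
rewrite [leRHS]/Num.Def.normr /= mx_normrE.
exact: (@le_bigmax _ _ _ _ (fun ij : 'I_m * 'I_n => `|x ij.1 ij.2|) (i, j)).
Qed.

Lemma mx_norm_le {m n : nat} (x : 'M[R]_(m, n)) (c : R) : 0 <= c ->
  (forall i j, `|x i j| <= c) -> `|x| <= c.
Proof.
move=> c0 xc; rewrite [leLHS]/Num.Def.normr /= mx_normrE.
by apply: bigmax_le => // -[i j] _; exact: xc.
Qed.

End Topology.

(** * Finite sums of extended reals *)

Section ExtendedSums.
Context {R : realType} {I : finType}.
Implicit Type F : I -> \bar R.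

Lemma sume_fineK F : (forall i, F i \is a fin_num) ->
  (\sum_i F i = (\sum_i fine (F i))%:E)%E.
Proof.
by move=> Ff; rewrite -sumEFin; apply: eq_bigr => i _; rewrite fineK.
Qed.

Lemma sume_neqNy F : (forall i, F i != -oo%E) -> (\sum_i F i != -oo)%E.
Proof.
move=> FN; apply/negP => /eqP/esum_eqNyP[i [_ _ Fi]].
by have := FN i; rewrite Fi.
Qed.

Lemma sume_fin F : (\sum_i F i)%E \is a fin_num -> forall i, F i \is a fin_num.
Proof. by move=> /sum_fin_numP H i; apply: H. Qed.

End ExtendedSums.

(** * The generalized Sinkhorn method as block ascent in logarithmic variables *)

Section Sinkhorn.
Context {R : realType} {T N : nat} {E : {set 'I_T * 'I_T}}.
Context (eps : R) (C : edge E -> 'M[\bar R]_N)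
  (g : 'I_T -> 'rV[R]_N -> \bar R) (f : edge E -> 'M[R]_N -> \bar R).
Local Notation B := ('I_T + edge E)%type.
Local Notation I := (mindex T N).
Local Notation blocks := (blocks R T N E).
Local Notation tensor := (tensor R T N).
Implicit Types (x y : blocks) (M : tensor).

(** Vertex vectors are one-row matrices, so vertices and edges form a single dependent family. *)
Definition block_rows (b : B) : nat := if b is inl _ then 1%N else N.
Definition block_cols (b : B) : nat := N.
Local Notation dblocks := (forall b : B, 'M[R]_(block_rows b, block_cols b)).

Definition block_index (b : B) : I -> 'I_(block_rows b) * 'I_(block_cols b) :=
  match b with
  | inl t => fun i => (ord0, i t)
  | inr e => fun i => (i (esrc e), i (etgt e))
  end.

Definition block_fun (b : B) : 'M[R]_(block_rows b, block_cols b) -> \bar R :=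
  match b with inl t => g t | inr e => f e end.

Definition family_of_blocks x : dblocks :=
  fun b => match b with inl t => x.1 t | inr e => x.2 e end.

Definition blocks_of_family (l : dblocks) : blocks :=
  (fun t => l (inl t), fun e => l (inr e)).

Definition log_family x : dblocks :=
  fun b => match b with
           | inl t => log_block eps (x.1 t)
           | inr e => log_block eps (x.2 e)
           end.

Local Notation K := (gibbs eps C).
Local Notation push := (pushfwd block_index).
Local Notation gibbsB := (gibbs_of block_index K eps).
Local Notation dfinite := (dual_finite block_fun).
Local Notation dvalue := (dual_value block_index K eps block_fun).
Local Notation pfinite := (primal_finite block_index block_fun).
Local Notation pvalue := (primal_value block_index K eps block_fun).
Local Notation bstep := (block_step block_index K eps block_fun).
Local Notation bpass := (block_pass block_index K eps block_fun).

Lemma family_of_blocksK l : family_of_blocks (blocks_of_family l) = l.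
Proof. by apply: boolp.functional_extensionality_dep => -[]. Qed.

Lemma pushfwd_vertex t M : push (inl t) M = marginal t M.
Proof.
apply/matrixP => a c; rewrite !mxE; apply: eq_bigl => i /=.
by rewrite xpair_eqE [a]ord1 eqxx.
Qed.

Lemma pushfwd_edge e M : push (inr e) M = bimarginal e M.
Proof. by apply/matrixP => a c; rewrite !mxE; apply: eq_bigl => i /=. Qed.

Hypothesis eps_gt0 : 0 < eps.
Hypothesis C_fin : forall i, cost_tensor C i \is a fin_num.
Hypothesis g_standing : forall t, standing_fun (g t).
Hypothesis f_standing : forall e, standing_fun (f e).

Let eps_neq0 : eps != 0. Proof. by rewrite gt_eqF. Qed.

Lemma block_fun_standing b : standing_fun (@block_fun b).
Proof. by case: b => [t|e]; [exact: g_standing|exact: f_standing]. Qed.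

Lemma gibbsE i : K i = expR (- fine (cost_tensor C i) * eps^-1).
Proof. by rewrite /gibbs -(fineK (C_fin i)). Qed.

Lemma gibbs_gt0 i : 0 < K i.
Proof. by rewrite gibbsE expR_gt0. Qed.

Lemma gibbs_of_prod (l : dblocks) i : gibbsB l i = K i *
  ((\prod_(t < T) expR (eps^-1 * l (inl t) ord0 (i t))) *
   (\prod_(e : edge E) expR (eps^-1 * l (inr e) (i (esrc e)) (i (etgt e))))).
Proof.
rewrite /gibbs_of /potential big_sumType/= mulrDr expRD !mulr_sumr !expR_sum.
by [].
Qed.

Lemma gibbs_of_exp x i :
  gibbsB (family_of_blocks x) i = K i * scaling_tensor (exp_blocks eps x) i.
Proof.
rewrite gibbs_of_prod; congr (_ * (_ * _)); apply: eq_bigr => ? _;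
  by rewrite !mxE.
Qed.

Lemma gibbs_of_log x : pos_blocks x ->
  gibbsB (log_family x) = scaled_gibbs eps C x.
Proof.
move=> [x1 x2]; apply/funext => i; rewrite gibbs_of_prod.
by congr (_ * (_ * _)); apply: eq_bigr => ? _; rewrite !mxE mulrA mulVf// mul1r;
  rewrite lnK// posrE; [exact: x1|exact: x2].
Qed.

Lemma block_update_pos b x y :
  pos_blocks x -> block_update eps C g f b x y -> pos_blocks y.
Proof.
move=> [x1 x2]; case: b => [j|j] [H1 H2 pj _]; split.
- by move=> t; have [->//|tj] := eqVneq t j; rewrite H1.
- by move=> e; rewrite H2.
- by move=> t; rewrite H1.
- by move=> e; have [->//|ej] := eqVneq e j; rewrite H2.
Qed.

Lemma sinkhorn_inclusion_subdifferential (m n : nat) (h : 'M[R]_(m, n) -> \bar R)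
    u w : sinkhorn_inclusion eps h u w ->
  subdifferential (conjugate h) (- log_block eps u) (hadamard u w).
Proof.
by move=> [s sd /eqP]; rewrite addrC subr_eq0 => /eqP <-.
Qed.

(** The weight is computed from the old state, but dividing by the old [x.1 j] removes its only
    dependence on that block; multiplying by the new block gives the marginal of the new tensor. *)
Lemma vertex_update_marginal j x y : pos_blocks x ->
  (forall t, t != j -> y.1 t = x.1 t) -> (forall e, y.2 e = x.2 e) ->
  hadamard (y.1 j) (vertex_weight eps C j x) =
  marginal j (scaled_gibbs eps C y).
Proof.
move=> [x1 x2] H1 H2; apply/matrixP => a c; rewrite !mxE [a]ord1.
rewrite mulrA mulrAC mulr_sumr; apply: eq_bigr => i /eqP ijc.
rewrite /scaled_gibbs /scaling_tensor !(bigD1 (P := predT) j)//= ijc.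
under [X in _ = _ * (_ * X * _)]eq_bigr => t tj do rewrite H1//.
under [X in _ = _ * (_ * X)]eq_bigr do rewrite H2.
by field; rewrite gt_eqF// x1.
Qed.

Lemma edge_update_bimarginal j x y : pos_blocks x ->
  (forall t, y.1 t = x.1 t) -> (forall e, e != j -> y.2 e = x.2 e) ->
  hadamard (y.2 j) (edge_weight eps C j x) =
  bimarginal j (scaled_gibbs eps C y).
Proof.
move=> [x1 x2] H1 H2; apply/matrixP => a c; rewrite !mxE.
rewrite mulrA mulrAC mulr_sumr; apply: eq_bigr => i /andP[/eqP ija /eqP ijc].
rewrite /scaled_gibbs /scaling_tensor !(bigD1 (P := predT) j)//= ija ijc.
under [X in _ = _ * (X * _)]eq_bigr do rewrite H1.
under [X in _ = _ * (_ * (_ * X))]eq_bigr => e ej do rewrite H2//.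
by field; rewrite gt_eqF// x2.
Qed.

Lemma block_update_step b x y : pos_blocks x ->
  block_update eps C g f b x y -> bstep b (log_family x) (log_family y).
Proof.
move=> px upd; have py := block_update_pos px upd.
rewrite /block_step gibbs_of_log//.
case: b upd => [j|j] [H1 H2 _ /sinkhorn_inclusion_subdifferential sd]; split.
- move=> [t tj|e _] /=; last by rewrite H2.
  by rewrite H1//; apply: contra tj => /eqP ->.
- by rewrite pushfwd_vertex -(vertex_update_marginal px).
- move=> [t _|e ej] /=; first by rewrite H1.
  by rewrite H2//; apply: contra ej => /eqP ->.
- by rewrite pushfwd_edge -(edge_update_bimarginal px).
Qed.

Lemma sinkhorn_pass_block_pass order x y : pos_blocks x ->
  sinkhorn_pass eps C g f order x y ->
  pos_blocks y /\ bpass order (log_family x) (log_family y).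
Proof.
elim: order x => [x px /= ->//|b o IH x px /= [z upd pz]].
have [py py'] := IH z (block_update_pos px upd) pz; split=> //.
by exists (log_family z) => //; exact: block_update_step.
Qed.

Lemma entropic_costE M : entropic_cost K eps M =
  \sum_i fine (cost_tensor C i) * M i + eps * entropy M.
Proof.
rewrite /entropic_cost /entropy mulr_sumr -big_split; apply: eq_bigr => i _ /=.
by rewrite gibbsE expRK; congr (_ + _); field.
Qed.

Lemma cost_valueE M :
  cost_value C M = (\sum_i fine (cost_tensor C i) * M i)%:E.
Proof.
rewrite /cost_value -sumEFin; apply: eq_bigr => i _.
by rewrite -{1}(fineK (C_fin i)) EFinM.
Qed.

Lemma primal_objectiveE p : primal_feasible p -> pfinite p.1 ->
  primal_objective eps C g f p = (pvalue p.1)%:E.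
Proof.
move=> [_ m1 m2] [_ D]; rewrite /primal_objective /primal_value entropic_costE.
rewrite cost_valueE big_sumType /= -!EFinD !sume_fineK.
- rewrite -!EFinD -!addrA; congr (_ + (_ + (_ + _)))%:E; apply: eq_bigr => i _.
    by rewrite pushfwd_vertex m1.
  by rewrite pushfwd_edge m2.
- move=> e; have := D (inr e); rewrite pushfwd_edge m2 => /= /proper_dom_fin[|v /= ->//].
  by have [] := f_standing e.
- move=> t; have := D (inl t); rewrite pushfwd_vertex m1 => /= /proper_dom_fin[|v /= ->//].
  by have [] := g_standing t.
Qed.

(** No summand is [-oo], so a finite total forces every summand to be finite. *)
Lemma primal_objective_finite p : primal_feasible p ->
  (primal_objective eps C g f p < +oo)%E -> pfinite p.1.
Proof.
move=> [p0 m1 m2]; rewrite /primal_objective cost_valueE -EFinD.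
have gN t : g t (p.2.1 t) != -oo%E by have [[]] := g_standing t.
have fN e : f e (p.2.2 e) != -oo%E by have [[]] := f_standing e.
move=> lty; have [G F] : (\sum_t g t (p.2.1 t))%E \is a fin_num /\
    (\sum_e f e (p.2.2 e))%E \is a fin_num.
  move: (sume_neqNy gN) (sume_neqNy fN) lty.
  by case: (\sum_t _)%E => [?||] //; case: (\sum_e _)%E => [?||].
split=> // -[t|e].
  by rewrite /dom/= pushfwd_vertex m1 ltey_eq (sume_fin G t).
by rewrite /dom/= pushfwd_edge m2 ltey_eq (sume_fin F e).
Qed.

(** The common extended-valued form of both dual objectives, reached from one by regrouping blocks
    and from the other by taking logarithms. *)
Definition dual_objective_family (l : dblocks) : \bar R :=
  ((- eps * \sum_i gibbsB l i)%:E
   - \sum_(t < T) conjugate (g t) (- l (inl t))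
   - \sum_(e : edge E) conjugate (f e) (- l (inr e)))%E.

Lemma dual_objective_familyE l : dfinite l ->
  dual_objective_family l = (dvalue l)%:E.
Proof.
move=> lf; rewrite /dual_objective_family /dual_value big_sumType/=.
rewrite !sume_fineK; [|by move=> e; exact: (lf (inr e))
  |by move=> t; exact: (lf (inl t))].
by rewrite -!EFinB opprD addrA.
Qed.

Lemma dual_objective_family_finite l :
  dual_objective_family l != -oo%E -> dfinite l.
Proof.
have gN t : conjugate (g t) (- l (inl t)) != -oo%E.
  by apply: conjugate_neqNy; have [] := g_standing t.
have fN e : conjugate (f e) (- l (inr e)) != -oo%E.
  by apply: conjugate_neqNy; have [] := f_standing e.
rewrite /dual_objective_family => nNy.
have [G F] : (\sum_t conjugate (g t) (- l (inl t)))%E \is a fin_num /\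
    (\sum_e conjugate (f e) (- l (inr e)))%E \is a fin_num.
  move: (sume_neqNy gN) (sume_neqNy fN) nNy.
  by case: (\sum_t _)%E => [?||] //; case: (\sum_e _)%E => [?||].
by move=> [t|e]; [exact: sume_fin G t|exact: sume_fin F e].
Qed.

Lemma dual_objective_blocks x :
  dual_objective eps C g f x = dual_objective_family (family_of_blocks x).
Proof.
by rewrite /dual_objective /dual_objective_family;
  under [X in _ = ((- _ * X)%:E - _ - _)%E]eq_bigr do rewrite gibbs_of_exp.
Qed.

Lemma dualu_objective_log x : pos_blocks x ->
  dualu_objective eps C g f x = dual_objective_family (log_family x).
Proof.
by move=> px; rewrite /dualu_objective /dual_objective_family gibbs_of_log.
Qed.

(** A family with an infinite conjugate has objective [-oo], so only finite ones have to be
    compared. *)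
Lemma le_dual_objective_family l l' : dfinite l' ->
  (dfinite l -> dvalue l <= dvalue l') ->
  (dual_objective_family l <= dual_objective_family l')%E.
Proof.
move=> l'f H.
have [->|] := eqVneq (dual_objective_family l) -oo%E; first exact: leNye.
by move=> /dual_objective_family_finite lf; rewrite !dual_objective_familyE// lee_fin H.
Qed.

End Sinkhorn.

Arguments block_fun {R T N E} g f b _.
Arguments block_rows {T N E} b.
Arguments block_cols {T N E} b.

(** * Convergence of the generalized Sinkhorn method *)

Theorem theorem3p11 (R : realType) (T N : nat) (E : {set 'I_T * 'I_T})
    (eps : R) (C : edge E -> 'M[\bar R]_N)
    (g : 'I_T -> 'rV[R]_N -> \bar R) (f : edge E -> 'M[R]_N -> \bar R)
    (x : nat -> blocks R T N E) :
  simple_graph E -> connected_graph E -> (1 <= N)%N -> 0 < eps ->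
  assumption_a C g f ->
  assumption_b C g f ->
  assumption_c g f ->
  sinkhorn_iterates eps C g f x ->
  let M k := scaled_gibbs eps C (x k) in
  [/\ bounded_tensors M,
      exists p : tensor R T N * blocks R T N E,
        [/\ primal_optimal eps C g f p,
            forall q, primal_optimal eps C g f q -> q = p
          & {ptws, M @ \oo --> p.1}]
    & dual_optimal eps C g f !=set0 ->
      bounded_blocks (dual_optimal eps C g f) ->
      bounded_blocks (range x) /\
      cluster (x @ \oo) `<=` dualu_optimal eps C g f].
Proof.
move=> _ _ _ eps0 [Cfin gs fs] [Mb [Mb0 _ gD fD [gri fri]]] _
  [order [uo fo x0 xp]] M.
have xpos k : pos_blocks (x k).
  by elim: k => // k IH; have [] := sinkhorn_pass_block_pass eps0 IH (xp k).
have lp k := (sinkhorn_pass_block_pass eps0 (xpos k) (xp k)).2.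
pose l k := log_family eps (x k).
have Mbf : primal_finite (@block_index T N E) (block_fun g f) Mb.
  split=> // -[t|e]; first by rewrite pushfwd_vertex; exact: gD.
  by rewrite pushfwd_edge; exact: fD.
have Mbri b : ~ polyhedral (block_fun g f b) ->
    rel_interior (dom (block_fun g f b)) (pushfwd (@block_index T N E) b Mb).
  case: b => [t|e] np; first by rewrite pushfwd_vertex; exact: gri.
  by rewrite pushfwd_edge; exact: fri.
have K0 := gibbs_gt0 eps Cfin.
have hst := block_fun_standing gs fs.
have [Mi [Mif Miopt Miuniq MiP]] :=
  block_ascent_primal K0 eps0 hst uo fo lp Mbf Mbri.
have MP i : M k i @[k --> \oo] --> Mi i.
  have -> : (fun k => M k i) =
      (fun k => gibbs_of (@block_index T N E) (gibbs eps C) eps (l k) i).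
    by apply/funext => k; rewrite /l (gibbs_of_log C eps0).
  exact: MiP.
split.
- have /choice[c cP] : forall i, exists c, forall k, `|M k i| <= c.
    move=> i; have /cvg_seq_bounded[c [_ cP]] : cvgn (fun k => M k i).
      by apply/cvg_ex; exists (Mi i).
    by exists (c + 1) => k; apply: cP => //; rewrite ltrDl.
  exists (\sum_i `|c i|) => k i; apply: (le_trans (cP i k)).
  by apply: (le_trans (ler_norm _)); rewrite (bigD1 i)//= lerDl sumr_ge0.
- pose p : tensor R T N * blocks R T N E :=
    (Mi, (fun t => marginal t Mi, fun e => bimarginal e Mi)).
  have pfeas : primal_feasible p by split=> //; exact: Mif.1.
  have pE : primal_objective eps C g f p =
      (primal_value (@block_index T N E) (gibbs eps C) eps (block_fun g f) Mi)%:E.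
    exact: (primal_objectiveE eps0 Cfin gs fs).
  exists p; split.
  + split=> // q qfeas; rewrite pE.
    have [->|] := eqVneq (primal_objective eps C g f q) +oo%E; first exact: leey.
    rewrite -ltey => /(primal_objective_finite Cfin gs fs qfeas) qfin.
    by rewrite (primal_objectiveE eps0 Cfin gs fs)// lee_fin Miopt.
  + move=> q [qfeas qopt].
    have qp := qopt _ pfeas; rewrite pE in qp.
    have qfin := primal_objective_finite Cfin gs fs qfeas (le_lt_trans qp (ltry _)).
    rewrite (primal_objectiveE eps0 Cfin gs fs)// lee_fin in qp.
    have q1 : q.1 = Mi by apply/funext => i; exact: Miuniq.
    case: q qfeas q1 {qopt qp qfin} => [q1 [q21 q22]] [/= _ m1 m2] q1E.
    rewrite /p -q1E; congr (_, (_, _)); apply: boolp.functional_extensionality_dep.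
      by move=> t; rewrite m1.
    by move=> e; rewrite m2.
  + exact: cvg_ptws.
- move=> [ls lsopt] [Bd BdP].
  (* The first iterate has a finite dual value, so the optimal value is not [-oo] and [ls] is dual
     finite. *)
  have l1f := iterates_finite K0 eps0 hst uo fo lp 0.
  have lsopt' l' : (dual_objective_family eps C g f l' <=
      dual_objective_family eps C g f (family_of_blocks ls))%E.
    rewrite -(family_of_blocksK l') -!dual_objective_blocks; exact: lsopt.
  have lsf : dual_finite (block_fun g f) (family_of_blocks ls).
    apply: (dual_objective_family_finite (eps := eps) (C := C) gs fs).
    have := lsopt' (l 1); rewrite dual_objective_familyE// -ltNye.
    by apply: lt_le_trans; rewrite ltNyr.
  (* A family at least as good as [ls] is itself dual optimal, hence entrywise bounded by [Bd]. *)
  have bnd l' : dual_finite (block_fun g f) l' ->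
      dual_value (@block_index T N E) (gibbs eps C) eps (block_fun g f)
        (family_of_blocks ls) <=
      dual_value (@block_index T N E) (gibbs eps C) eps (block_fun g f) l' ->
      entry_sum l' <= \sum_(b : 'I_T + edge E) \sum_(i < @block_rows T N E b)
        \sum_(j < @block_cols T N E b) Bd.
    move=> l'f le_ls.
    have [|B1 B2] := BdP (blocks_of_family l').
      move=> l''; apply: (@le_trans _ _ (dual_objective eps C g f ls)).
        exact: lsopt.
      rewrite !dual_objective_blocks family_of_blocksK.
      by rewrite !dual_objective_familyE// lee_fin.
    have ent b i j : `|l' b i j| <= Bd.
      case: b i j => [t|e] i j.
        exact: le_trans (entry_le_mx_norm (l' (inl t)) i j) (B1 t).
      exact: le_trans (entry_le_mx_norm (l' (inr e)) i j) (B2 e).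
    by do 3 (apply: ler_sum => ? _); exact: ent.
  have [c cP] := block_ascent_dual_bounded K0 eps0 hst uo fo lp Mbf lsf bnd.
  (* Bounded logarithms bound the scalings above and away from 0; the lower bound keeps cluster
     points positive, where [ln] is continuous. *)
  have lnb (u : R) : 0 < u -> `|eps * ln u| <= c ->
      expR (- (eps^-1 * c)) <= u <= expR (eps^-1 * c).
    move=> u0 /ler_normlP[h1 h2].
    have uE : u = expR (eps^-1 * (eps * ln u)).
      by rewrite mulrA mulVf ?gt_eqF// mul1r lnK.
    rewrite uE !ler_expR -mulrN !ler_pM2l ?invr_gt0// lerNl; exact/andP.
  have xb1 k t i j : expR (- (eps^-1 * c)) <= (x k).1 t i j <= expR (eps^-1 * c).
    apply: lnb; first exact: (xpos k).1.
    by have := cP k (inl t) i j; rewrite !mxE.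
  have xb2 k e i j : expR (- (eps^-1 * c)) <= (x k).2 e i j <= expR (eps^-1 * c).
    apply: lnb; first exact: (xpos k).2.
    by have := cP k (inr e) i j; rewrite !mxE.
  split.
    exists (expR (eps^-1 * c)) => _ [k _ <-]; split=> [t|e].
      apply: mx_norm_le => [|i j]; first exact: expR_ge0.
      by rewrite ger0_norm ?(ltW ((xpos k).1 _ _ _))//; case/andP: (xb1 k t i j).
    apply: mx_norm_le => [|i j]; first exact: expR_ge0.
    by rewrite ger0_norm ?(ltW ((xpos k).2 _ _ _))//; case/andP: (xb2 k e i j).
  move=> p /cluster_ultra[U UU [ooU xU]].
  have xU1 t i j : (x k).1 t i j @[k --> U] --> p.1 t i j.
    apply: cvg_mx_coord; apply: (@cvg_ptws_coord _ U _ _ _ (fun k => (x k).1)).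
    exact: (cvg_comp _ _ xU (@cvg_fst _ _ _ _ _)).
  have xU2 e i j : (x k).2 e i j @[k --> U] --> p.2 e i j.
    apply: cvg_mx_coord; apply: (@cvg_ptws_coord _ U _ _ _ (fun k => (x k).2)).
    exact: (cvg_comp _ _ xU (@cvg_snd _ _ _ _ _)).
  have pp : pos_blocks p.
    split=> [t i j|e i j]; apply: (lt_le_trans (expR_gt0 (- (eps^-1 * c)))).
      apply: (cvg_ge_near _ (xU1 t i j)); apply: filterE => k.
      by case/andP: (xb1 k t i j).
    apply: (cvg_ge_near _ (xU2 e i j)); apply: filterE => k.
    by case/andP: (xb2 k e i j).
  have lU b : l k b @[k --> U] --> log_family eps p b.
    case: b => [t|e]; apply: cvg_mx => i j; rewrite !mxE;
      under eq_fun do rewrite !mxE; apply: cvgM; first exact: cvg_cst.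
    - exact: (cvg_comp _ _ (xU1 t i j) (continuous_ln (pp.1 t i j))).
    - exact: cvg_cst.
    - exact: (cvg_comp _ _ (xU2 e i j) (continuous_ln (pp.2 e i j))).
  have [pf popt] := block_ascent_dual_cluster K0 eps0 hst uo fo lp Mbf Mbri UU ooU lU.
  split=> // y yp; rewrite !(dualu_objective_log _ _ _ eps0)//.
  by apply: (le_dual_objective_family gs fs) => // yf; exact: popt.
Qed.
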